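(* There exist positive absolute constants $K_1,K_2,K_3$ such that for all $n\ge 2$, all real $n\times n$ matrices $A=(a_{ij})$ with $\sigma_A>0$, and all twice differentiable functions $q:\mathbb{R}\to\mathbb{R}$ such that $q,q',q''$ are bounded, $$\Big|E\big(q(\mathscr{T}_A)\big)-\int_{\mathbb{R}} q(x)\,e_{1,A}'(x)\,dx\Big|\le \big(K_1\|q\|+K_2\|q'\|+K_3\|q''\|\big)D_A^2 .$$
   Context: $\|g\|=\sup_{z\in\mathbb{R}}|g(z)|$. For a real $n\times n$ matrix $A=(a_{ij})$, $n\ge2$: $\mu_A=\frac1n\sum_{i,j}a_{ij}$; $\breve a_{ij}=a_{ij}-\frac1n\sum_l a_{il}-\frac1n\sum_k a_{kj}+\frac1{n^2}\sum_{k,l}a_{kl}$; $\sigma_A^2=\frac1{n-1}\sum_{i,j}\breve a_{ij}^2$ ($\sigma_A\ge 0$); if $\sigma_A>0$, $\hat a_{ij}=\breve a_{ij}/\sigma_A$. Let $\pi$ be a uniformly distributed random permutation of $\{1,\dots,n\}$ and $\mathscr{T}_A=\big(\sum_i a_{i\pi(i)}-\mu_A\big)/\sigma_A=\sum_i\hat a_{i\pi(i)}$. Put $D_A=\big(\frac1n\sum_{i,j}|\hat a_{ij}|^4\big)^{1/2}$ and $\lambda_{1,A}=\frac1n\sum_{i,j}\hat a_{ij}^3$. With $\Phi$ the standard normal distribution function and $\psi=\Phi'$, let $e_{1,A}(x)=\Phi(x)-\frac16\lambda_{1,A}(x^2-1)\psi(x)$. *)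

(* Defs.v *)
From mathcomp Require Export all_boot all_order all_algebra all_fingroup.
From mathcomp Require Export all_classical all_reals all_analysis.
Export Order.TTheory GRing.Theory Num.Theory.
Export numFieldNormedType.Exports.

Set Implicit Arguments.
Unset Strict Implicit.
Unset Printing Implicit Defensive.

Local Open Scope ring_scope.
Local Open Scope classical_set_scope.

(* For unbounded [g] the real-valued [sup] is a junk value; only meant to be
   used together with a boundedness hypothesis. *)
Definition supnorm {R : realType} (g : R -> R) : R :=
  sup [set `|g z| | z in [set: R]].

Definition muA {R : realType} {n : nat} (A : 'M[R]_n) : R :=
  n%:R^-1 * \sum_i \sum_j A i j.

Definition breveA {R : realType} {n : nat} (A : 'M[R]_n) : 'M[R]_n :=
  \matrix_(i, j) (A i j - n%:R^-1 * (\sum_l A i l) - n%:R^-1 * (\sum_k A k j)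
                  + (n%:R ^+ 2)^-1 * (\sum_k \sum_l A k l)).

Definition sigmaA {R : realType} {n : nat} (A : 'M[R]_n) : R :=
  Num.sqrt (n.-1%:R^-1 * \sum_i \sum_j breveA A i j ^+ 2).

Definition hatA {R : realType} {n : nat} (A : 'M[R]_n) : 'M[R]_n :=
  \matrix_(i, j) (breveA A i j / sigmaA A).

Definition TA {R : realType} {n : nat} (A : 'M[R]_n) (s : 'S_n) : R :=
  (\sum_i A i (s i) - muA A) / sigmaA A.

Definition DA {R : realType} {n : nat} (A : 'M[R]_n) : R :=
  Num.sqrt (n%:R^-1 * \sum_i \sum_j `|hatA A i j| ^+ 4).

Definition lambda1A {R : realType} {n : nat} (A : 'M[R]_n) : R :=
  n%:R^-1 * \sum_i \sum_j hatA A i j ^+ 3.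

Definition Phi {R : realType} (x : R) : R :=
  fine (normal_prob (0 : R) 1 `]-oo, x]).

Definition psi {R : realType} : R -> R := derive1 Phi.

Definition e1A {R : realType} {n : nat} (A : 'M[R]_n) (x : R) : R :=
  Phi x - 6^-1 * lambda1A A * (x ^+ 2 - 1) * psi x.

(* ['S_n] is not equipped with a sigma-algebra: since it is finite,
   measurability of [p] for the discrete one is measurability of the fibres. *)
Definition uniform_random_perm {d : measure_display} {T : measurableType d}
    {R : realType} (P : probability T R) {n : nat} (p : T -> 'S_n) : Prop :=
  forall s : 'S_n,
    measurable (p @^-1` [set s]) /\
    P (p @^-1` [set s]) = ((n`!)%:R^-1)%:E.

(* Main.v *)
(* Stein's method for the transposition coupling. Let [B i k = a i (s k)], where
   [a] is the normalized matrix, whose rows and columns sum to zero, so that the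
   statistic is the trace [T] of [B]. Composing the uniform permutation [s] with
   the transposition [(i k)] preserves its law, exchanges columns [i] and [k] of
   [B] and shifts [T] by [delta i k = B i k + B k i - B i i - B k k]. Hence
     [n E[T f(T)] = E sum_(i, k) B i k (f(T + delta i k) - f(T))],
   whose Taylor expansion is [n E f'(T) + n lambda / 2 E f''(T)] up to
   expectations of [f'(T)], [f''(T)] against polynomials in the entries of [B]
   which are zero on average. Applying the transposition once more to each of these
   brings out the row sums, the trace [T] or the form [b^T B b] of the diagonal
   [b] of [B], so that they are O(sum a^4) = O(n D^2); note that [n D^2 >= 1/4].
   A first-order version of the argument shows that [E f''(T)] is within O(D) of
   its Gaussian value, and [|lambda| <= D].
   The derivatives of the Stein solutions are all estimated by one comparison
   principle: if [u' = x u + g] with [u] bounded, then [|x u| <= sup |g|]. *)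
From HB Require Import structures.
Require Import Defs.
From mathcomp Require Import measurable_realfun ring lra.

Set Implicit Arguments.
Unset Strict Implicit.
Unset Printing Implicit Defensive.

Local Open Scope ring_scope.

(** * Means over permutations *)

Section PermMean.
Variables (R : realFieldType) (n : nat).
Implicit Types F G : 'S_n -> R.

Definition pmean F : R := (n`!)%:R^-1 * \sum_s F s.

Lemma eq_pmean F G : F =1 G -> pmean F = pmean G.
Proof. by move=> FG; rewrite /pmean (eq_bigr _ (fun s _ => FG s)). Qed.

Lemma pmeanD F G : pmean (fun s => F s + G s) = pmean F + pmean G.
Proof. by rewrite /pmean big_split mulrDr. Qed.

Lemma pmeanZ c F : pmean (fun s => c * F s) = c * pmean F.
Proof. by rewrite /pmean -big_distrr /= mulrCA. Qed.

Lemma pmeanZr c F : pmean (fun s => F s * c) = pmean F * c.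
Proof. by rewrite /pmean -big_distrl /= mulrA. Qed.

Lemma pmeanN F : pmean (fun s => - F s) = - pmean F.
Proof. by rewrite /pmean sumrN mulrN. Qed.

Lemma pmeanB F G : pmean (fun s => F s - G s) = pmean F - pmean G.
Proof. by rewrite pmeanD pmeanN. Qed.

Lemma pmean_sum (I : finType) (P : pred I) (F : I -> 'S_n -> R) :
  pmean (fun s => \sum_(i | P i) F i s) = \sum_(i | P i) pmean (F i).
Proof. by rewrite /pmean exchange_big /= big_distrr. Qed.

Lemma pmean_cst c : pmean (fun=> c) = c.
Proof.
rewrite /pmean sumr_const card_Sn -[c *+ _]mulr_natl mulrA.
by rewrite mulVf ?mul1r // pnatr_eq0 -lt0n fact_gt0.
Qed.

Lemma le_pmean F G : (forall s, F s <= G s) -> pmean F <= pmean G.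
Proof.
by move=> FG; rewrite ler_wpM2l ?invr_ge0 ?ler0n //; apply: ler_sum => s _.
Qed.

Lemma norm_pmean F : `|pmean F| <= pmean (fun s => `|F s|).
Proof.
by rewrite normrM ger0_norm ?invr_ge0 ?ler0n // ler_wpM2l ?invr_ge0 ?ler0n // ler_norm_sum.
Qed.

Lemma norm_pmean_le F G : (forall s, `|F s| <= G s) -> `|pmean F| <= pmean G.
Proof. by move=> FG; apply: le_trans (norm_pmean _) (le_pmean _). Qed.

Lemma pmean_tperm (i k : 'I_n) F : pmean (fun s => F (tperm i k * s)%g) = pmean F.
Proof.
by rewrite /pmean [in RHS](reindex_inj (mulgI (tperm i k))).
Qed.

(** By transposition invariance the mean of [u (s i)] does not depend on [i]; summed over all [i] it
    is the mean of a quantity that no longer depends on [s]. *)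
Lemma pmean_perm1 (u : 'I_n -> R) (i : 'I_n) :
  n%:R * pmean (fun s => u (s i)) = \sum_j u j.
Proof.
have -> : n%:R * pmean (fun s => u (s i)) = \sum_(k < n) pmean (fun s => u (s k)).
  transitivity (\sum_(k < n) pmean (fun s => u (s i))).
    by rewrite sumr_const card_ord mulr_natl.
  apply: eq_bigr => k _; rewrite -(pmean_tperm i k).
  by apply: eq_pmean => s; rewrite permM tpermR || rewrite permM tpermL.
rewrite -pmean_sum -[RHS]pmean_cst; apply: eq_pmean => s.
by rewrite [RHS](reindex_inj (@perm_inj _ s)).
Qed.

End PermMean.

(** * Second moment of a linear permutation statistic *)

Section LinearStatistic.
Variables (R : realFieldType) (n : nat) (M : 'I_n -> 'I_n -> R).
Hypothesis n2 : (2 <= n)%N.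
Hypothesis colM : forall j, \sum_i M i j = 0.

(** The cross moments reduce to functions of the single value [s k]. After summation over [k'] the
    zero column sums leave [n E (M k (s k))^2 - r k E M k (s k)], where the subtracted term equals
    [r k ^ 2 / n], hence the inequality. The rows are left free so that the lemma also covers the
    matrices [a i j * a k j] of [pmean_diag_image_sqr]. *)
Lemma pmean_linear_sqr :
  n.-1%:R * pmean (fun s => (\sum_i M i (s i)) ^+ 2) <= \sum_i \sum_j M i j ^+ 2.
Proof.
have n0 : (0 < n%:R :> R) by rewrite ltr0n; case: (n) n2.
pose r i := \sum_j M i j.
have nE : n%:R = n.-1%:R + 1 :> R by case: (n) n2 => // m _; rewrite -natr1.
(* Transposing [k'] with each [m != k] fixes [s k] and averages [s k'] over the [n - 1] values other
   than [s k]. *)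
have off k k' : k' != k ->
  n.-1%:R * pmean (fun s => M k (s k) * M k' (s k')) =
  pmean (fun s => M k (s k) * (r k' - M k' (s k))).
  move=> kk'.
  have -> : n.-1%:R * pmean (fun s => M k (s k) * M k' (s k')) =
     \sum_(m < n | m != k) pmean (fun s => M k (s k) * M k' (s m)).
    transitivity (\sum_(m < n | m != k) pmean (fun s => M k (s k) * M k' (s k'))).
      by rewrite sumr_const -cardsE cardsE cardC1 card_ord mulr_natl.
    apply: eq_bigr => m mk; rewrite -(pmean_tperm k' m).
    by apply: eq_pmean => s; rewrite !permM tpermL tpermD // eq_sym.
  rewrite -pmean_sum; apply: eq_pmean => s; rewrite -big_distrr /=; congr (_ * _).
  rewrite /r [in RHS](reindex_inj (@perm_inj _ s)) /= [in RHS](bigD1 k) //=.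
  by rewrite [RHS]addrC addKr.
have -> : pmean (fun s => (\sum_i M i (s i)) ^+ 2) =
   \sum_k (pmean (fun s => M k (s k) ^+ 2) +
   \sum_(k' | k' != k) pmean (fun s => M k (s k) * M k' (s k'))).
  under [RHS]eq_bigr do rewrite -pmean_sum -pmeanD.
  rewrite -pmean_sum; apply: eq_pmean => s.
  rewrite expr2 big_distrl /=; apply: eq_bigr => k _.
  by rewrite (bigD1 k) //= mulrDr expr2 big_distrr.
rewrite big_distrr /=.
apply: ler_sum => k _.
rewrite mulrDr big_distrr /= (eq_bigr _ (fun k' kk' => off k k' kk')) -pmean_sum.
rewrite -pmeanZ -pmeanD.
have -> : pmean (fun s => n.-1%:R * M k (s k) ^+ 2 +
    \sum_(k' | k' != k) M k (s k) * (r k' - M k' (s k))) =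
   pmean (fun s => n%:R * M k (s k) ^+ 2 - r k * M k (s k)).
  apply: eq_pmean => s; rewrite -big_distrr /= big_split /= sumrN.
  have r0 : \sum_k' r k' = 0 by rewrite /r exchange_big big1.
  have := r0; rewrite (bigD1 k) //= => /eqP; rewrite addrC addr_eq0 => /eqP ->.
  have := colM (s k); rewrite (bigD1 k) //= => /eqP; rewrite addrC addr_eq0 => /eqP ->.
  by rewrite nE; ring.
rewrite pmeanB !pmeanZ (pmean_perm1 (fun j => M k j ^+ 2)).
rewrite lerBlDr lerDl -(pmulr_rge0 _ n0) mulrCA (pmean_perm1 (M k)) -expr2.
exact: sqr_ge0.
Qed.

End LinearStatistic.

(** * Elementary inequalities of Young and Cauchy-Schwarz type *)

Section Inequalities.
Variable R : realFieldType.
Implicit Types x y z t : R.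

Lemma mulr_le_half_sqr x y : `|x * y| <= (x ^+ 2 + y ^+ 2) / 2.
Proof.
rewrite normrM -(real_normK (num_real x)) -(real_normK (num_real y)).
by have := sqr_ge0 (`|x| - `|y|); rewrite sqrrB; lra.
Qed.

Lemma sqr_add4_le x y z t :
  (x + y + z + t) ^+ 2 <= 4 * (x ^+ 2 + y ^+ 2 + z ^+ 2 + t ^+ 2).
Proof.
have := sqr_ge0 (x - y); have := sqr_ge0 (x - z); have := sqr_ge0 (x - t).
have := sqr_ge0 (y - z); have := sqr_ge0 (y - t); have := sqr_ge0 (z - t).
by lra.
Qed.

Lemma exp4_add4_le x y z t :
  (x + y + z + t) ^+ 4 <= 64 * (x ^+ 4 + y ^+ 4 + z ^+ 4 + t ^+ 4).
Proof.
have e4 u : u ^+ 4 = (u ^+ 2) ^+ 2 by rewrite -exprM.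
rewrite !e4; apply: le_trans (_ : 16 * (x ^+ 2 + y ^+ 2 + z ^+ 2 + t ^+ 2) ^+ 2 <= _).
  rewrite (_ : 16 = 4 ^+ 2); last by ring.
  by rewrite -exprMn lerXn2r ?nnegrE ?sqr_ge0 ?mulr_ge0 ?addr_ge0 ?sqr_ge0 // sqr_add4_le.
by have := sqr_add4_le (x ^+ 2) (y ^+ 2) (z ^+ 2) (t ^+ 2); lra.
Qed.

Lemma sumr_cst m x : \sum_(i < m) x = m%:R * x.
Proof. by rewrite sumr_const card_ord mulr_natl. Qed.

Lemma sqr_sum_le m (x : 'I_m -> R) : (\sum_i x i) ^+ 2 <= m%:R * \sum_i x i ^+ 2.
Proof.
rewrite expr2 big_distrl /=.
apply: le_trans (_ : \sum_(i < m) \sum_(j < m) (x i ^+ 2 + x j ^+ 2) / 2 <= _).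
  apply: ler_sum => i _; rewrite big_distrr /=; apply: ler_sum => j _.
  exact: le_trans (ler_norm _) (mulr_le_half_sqr _ _).
under [leLHS]eq_bigr do rewrite -mulr_suml /= big_split /= sumr_cst.
by rewrite -mulr_suml /= big_split /= sumr_cst -mulr_sumr; lra.
Qed.

End Inequalities.

(** * The permuted matrix [B], its transpositions and its moments *)

Section SwapExpansion.
Variables (R : realFieldType) (n : nat) (a : 'I_n -> 'I_n -> R).
Hypothesis n2 : (2 <= n)%N.
Hypothesis rowa : forall i, \sum_j a i j = 0.
Hypothesis cola : forall j, \sum_i a i j = 0.
Hypothesis suma2 : \sum_i \sum_j a i j ^+ 2 = n.-1%:R.

Implicit Types (s : 'S_n) (i k : 'I_n).

Definition perm_entry s i k := a i (s k).
Definition perm_stat s := \sum_i perm_entry s i i.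
Definition swap_shift s i k :=
  perm_entry s i k + perm_entry s k i - perm_entry s i i - perm_entry s k k.
(** A common majorant of the four entries that a transposition moves and of [delta]: a product of
    [p] such factors is at most [w ^ p]. *)
Definition swap_width s i k :=
  `|perm_entry s i k| + `|perm_entry s k i| + `|perm_entry s i i| + `|perm_entry s k k|.

Local Notation B := perm_entry.
Local Notation T := perm_stat.
Local Notation delta := swap_shift.
Local Notation w := swap_width.
Local Notation S4 := (\sum_i \sum_j a i j ^+ 4).

Definition diag_sqr s := \sum_i B s i i ^+ 2.
Definition diag_form s := \sum_i \sum_k B s i i * B s k k * B s i k.
(** The squared Euclidean norm of [B b], with [b] the diagonal of [B]; it controls the quadratic
    form [diag_form] by Young's inequality. *)
Definition diag_image_sqr s := \sum_i (\sum_k B s i k * B s k k) ^+ 2.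
Definition sum_width p s := \sum_i \sum_k w s i k ^+ p.

Lemma perm_entryL s i k : B (tperm i k * s) i i = B s i k.
Proof. by rewrite /perm_entry permM tpermL. Qed.

Lemma perm_entryR s i k : B (tperm i k * s) k k = B s k i.
Proof. by rewrite /perm_entry permM tpermR. Qed.

Lemma perm_entryLR s i k : B (tperm i k * s) i k = B s i i.
Proof. by rewrite /perm_entry permM tpermR. Qed.

Lemma perm_entryRL s i k : B (tperm i k * s) k i = B s k k.
Proof. by rewrite /perm_entry permM tpermL. Qed.

Lemma perm_stat_tperm s i k : T (tperm i k * s) = T s + delta s i k.
Proof.
have [<-|ik] := eqVneq i k.
  by rewrite tperm1 mul1g /swap_shift; ring.
rewrite /perm_stat (bigD1 i) //= (bigD1 k) 1?eq_sym //= perm_entryL perm_entryR.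
rewrite [in RHS](bigD1 i) //= [in RHS](bigD1 k) 1?eq_sym //= /swap_shift.
rewrite (eq_bigr (fun j => B s j j)); first by ring.
by move=> j /andP[ji jk]; rewrite /perm_entry permM tpermD // eq_sym.
Qed.

Lemma sum_perm_entry_row s i : \sum_k B s i k = 0.
Proof. by rewrite -[RHS](rowa i) [RHS](reindex_inj (@perm_inj _ s)). Qed.

Lemma sum_perm_entry_col s k : \sum_i B s i k = 0.
Proof. exact: cola. Qed.

Lemma sum_perm_entry s (u : R -> R) :
  \sum_i \sum_k u (B s i k) = \sum_i \sum_j u (a i j).
Proof.
by apply: eq_bigr => i _; rewrite [RHS](reindex_inj (@perm_inj _ s)).
Qed.

(** Each term of the double sum is transformed by its own transposition, which is the identity when
    [i = k]. *)
Lemma pmean_sum_swap (X Y : 'S_n -> 'I_n -> 'I_n -> R) :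
  (forall s i k, X (tperm i k * s)%g i k = Y s i k) ->
  pmean (fun s => \sum_i \sum_k X s i k) = pmean (fun s => \sum_i \sum_k Y s i k).
Proof.
move=> XY; rewrite !pmean_sum; apply: eq_bigr => i _.
rewrite !pmean_sum; apply: eq_bigr => k _.
by rewrite -(pmean_tperm i k); apply: eq_pmean => s.
Qed.

Lemma n_gt0 : 0 < n%:R :> R.
Proof. by rewrite ltr0n; case: (n) n2. Qed.

Lemma natr_pred : n.-1%:R = n%:R - 1 :> R.
Proof. by case: (n) n2 => // m _; rewrite -natr1 addrK. Qed.

Lemma natr_ge2 : 2 <= n%:R :> R.
Proof. by rewrite ler_nat. Qed.

Lemma pmean_diag (u : R -> R) :
  n%:R * pmean (fun s => \sum_i u (B s i i)) = \sum_i \sum_j u (a i j).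
Proof.
rewrite pmean_sum big_distrr /=; apply: eq_bigr => i _.
exact: (pmean_perm1 (fun j => u (a i j))).
Qed.

(** Each of the four entries in [w] contributes [64 * S4]. The two off-diagonal ones do so for every
    [s]; the two diagonal ones only on average, [n] times the mean of the diagonal sum being the
    full sum. *)
Lemma pmean_sum_width4 : pmean (sum_width 4) <= 256 * S4.
Proof.
apply: le_trans (_ : pmean (fun s => 64 * (2 * S4 +
    2 * (n%:R * \sum_i B s i i ^+ 4))) <= _); last first.
  rewrite pmeanZ pmeanD pmean_cst !pmeanZ (pmean_diag (fun x => x ^+ 4)); lra.
apply: le_pmean => s; rewrite /sum_width.
apply: le_trans (_ : \sum_i \sum_k 64 *
  (B s i k ^+ 4 + B s k i ^+ 4 + B s i i ^+ 4 + B s k k ^+ 4) <= _).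
  apply: ler_sum => i _; apply: ler_sum => k _.
  apply: le_trans (exp4_add4_le _ _ _ _) _.
  by rewrite -!normrX !(ger0_norm (exprn_even_ge0 _ _)).
under eq_bigr do rewrite -mulr_sumr !big_split /= sumr_cst.
rewrite -mulr_sumr /= !big_split /= sumr_cst -mulr_sumr.
rewrite [X in _ * (_ + X + _ + _)]exchange_big /= (sum_perm_entry s (fun x => x ^+ 4)).
lra.
Qed.

Lemma pmean_sum_width2 : pmean (sum_width 2) <= 16 * n%:R.
Proof.
apply: le_trans (_ : pmean (fun s => 4 * (2 * n%:R +
    2 * (n%:R * \sum_i B s i i ^+ 2))) <= _); last first.
  rewrite pmeanZ pmeanD pmean_cst !pmeanZ (pmean_diag (fun x => x ^+ 2)) suma2.
  rewrite natr_pred; lra.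
apply: le_pmean => s; rewrite /sum_width.
apply: le_trans (_ : \sum_i \sum_k 4 *
  (B s i k ^+ 2 + B s k i ^+ 2 + B s i i ^+ 2 + B s k k ^+ 2) <= _).
  apply: ler_sum => i _; apply: ler_sum => k _.
  apply: le_trans (sqr_add4_le _ _ _ _) _.
  by rewrite -!normrX !(ger0_norm (exprn_even_ge0 _ _)).
under eq_bigr do rewrite -mulr_sumr !big_split /= sumr_cst.
rewrite -mulr_sumr /= !big_split /= sumr_cst -mulr_sumr.
rewrite [X in _ * (_ + X + _ + _)]exchange_big /= (sum_perm_entry s (fun x => x ^+ 2)).
rewrite suma2 natr_pred; lra.
Qed.

(** Summing [x^4 >= 2 t x^2 - t^2] at [t = 1 / (2 n)] gives [S4 >= 3/4 - 1/n], and [n >= 2]. This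
    lower bound lets every constant term be absorbed into a multiple of [S4]. *)
Lemma sum4_ge : 4^-1 <= S4.
Proof.
apply: le_trans (_ : \sum_i \sum_j (n%:R^-1 * a i j ^+ 2 - (4 * n%:R ^+ 2)^-1) <= _).
  have n0 := n_gt0.
  under eq_bigr do rewrite big_split -mulr_sumr /= sumr_cst.
  rewrite big_split -mulr_sumr /= sumr_cst suma2 natr_pred.
  have -> : n%:R^-1 * (n%:R - 1) + n%:R * (n%:R * - (4 * n%:R ^+ 2)^-1) =
     3 / 4 - n%:R^-1 :> R.
    by field; rewrite gt_eqF.
  have : n%:R^-1 <= 2^-1 :> R by rewrite lef_pV2 ?posrE // natr_ge2.
  lra.
apply: ler_sum => i _; apply: ler_sum => j _.
have -> : (4 * n%:R ^+ 2)^-1 = ((2 * n%:R)^-1) ^+ 2 :> R.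
  by field; rewrite gt_eqF ?n_gt0.
have -> : n%:R^-1 = 2 * (2 * n%:R)^-1 :> R by field; rewrite gt_eqF ?n_gt0.
have := sqr_ge0 (a i j ^+ 2 - (2 * n%:R)^-1).
set t := (2 * n%:R)^-1.
lra.
Qed.

Lemma pmean_perm_stat2 : pmean (fun s => T s ^+ 2) <= 1.
Proof.
have n0 : 0 < n.-1%:R :> R by rewrite natr_pred; have := natr_ge2; lra.
rewrite -(ler_pM2l n0) mulr1.
by apply: le_trans (pmean_linear_sqr n2 cola) _; rewrite suma2.
Qed.

Lemma pmean_diag_sqr : pmean diag_sqr <= 1.
Proof.
rewrite -(ler_pM2l n_gt0) mulr1 (pmean_diag (fun x => x ^+ 2)) suma2 natr_pred; lra.
Qed.

(** For fixed [i], the [i]-th coordinate of [B b] is the linear statistic of the matrix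
    [a i j * a k j] in [(k, j)], whose column sums vanish. Young's inequality then gives [n * S4],
    and [n <= 2 (n - 1)]. *)
Lemma pmean_diag_image_sqr : pmean diag_image_sqr <= 2 * S4.
Proof.
have n0 : 0 < n.-1%:R :> R by rewrite natr_pred; have := natr_ge2; lra.
rewrite -(ler_pM2l n0) pmean_sum big_distrr /=.
apply: le_trans (_ : \sum_i \sum_k \sum_j (a i j ^+ 4 + a k j ^+ 4) / 2 <= _).
  apply: ler_sum => i _.
  apply: (le_trans (@pmean_linear_sqr _ _ (fun k j => a i j * a k j) n2 _)).
    by move=> j; rewrite -mulr_sumr /= cola mulr0.
  apply: ler_sum => k _; apply: ler_sum => j _.
  rewrite exprMn.
  have e4 (u : R) : u ^+ 4 = (u ^+ 2) ^+ 2 by rewrite -exprM.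
  rewrite !e4.
  exact: le_trans (ler_norm _) (mulr_le_half_sqr _ _).
have -> : \sum_i \sum_k \sum_j (a i j ^+ 4 + a k j ^+ 4) / 2 = n%:R * S4.
  under eq_bigr do under eq_bigr do rewrite -mulr_suml big_split.
  under eq_bigr do rewrite -mulr_suml big_split /= sumr_cst.
  rewrite -mulr_suml big_split /= sumr_cst -mulr_sumr; lra.
have S0 : 0 <= S4 by have := sum4_ge; lra.
rewrite mulrA; apply: ler_wpM2r => //; rewrite natr_pred; have := natr_ge2; lra.
Qed.

Lemma diag_form_le s : `|diag_form s| <= (diag_sqr s + diag_image_sqr s) / 2.
Proof.
rewrite /diag_form /diag_sqr /diag_image_sqr -big_split big_distrl /=.
apply: le_trans (ler_norm_sum _ _ _) _; apply: ler_sum => i _.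
have -> : \sum_k B s i i * B s k k * B s i k = B s i i * \sum_k B s i k * B s k k.
  by rewrite big_distrr /=; apply: eq_bigr => k _; ring.
exact: mulr_le_half_sqr.
Qed.

Lemma pmean_diag_form : pmean (fun s => `|diag_form s|) <= 3 * S4.
Proof.
apply: le_trans (le_pmean diag_form_le) _.
apply: le_trans (_ : (pmean diag_sqr + pmean diag_image_sqr) / 2 <= _).
  by rewrite pmeanZr pmeanD.
(* The bound is [(1 + 2 S4) / 2], with [1 <= 4 S4]. *)
have := pmean_diag_sqr; have := pmean_diag_image_sqr; have := sum4_ge; lra.
Qed.

Lemma swap_width_ge s i k : [/\ `|B s i k| <= w s i k, `|B s k i| <= w s i k,
  `|B s i i| <= w s i k, `|B s k k| <= w s i k & `|delta s i k| <= w s i k].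
Proof.
have b1 := normr_ge0 (B s i k); have b2 := normr_ge0 (B s k i).
have b3 := normr_ge0 (B s i i); have b4 := normr_ge0 (B s k k).
rewrite /swap_width; split; try lra.
by rewrite /swap_shift !(le_trans (ler_normB _ _)) ?lerD ?ler_normD // ?lerD ?ler_normB
  // (le_trans (ler_normB _ _)) ?lerD ?ler_normD.
Qed.

Lemma swap_width_ge0 s i k : 0 <= w s i k.
Proof. by have [+ _ _ _ _] := swap_width_ge s i k; apply: le_trans. Qed.

Lemma norm_mul3_le (x y z W : R) :
  `|x| <= W -> `|y| <= W -> `|z| <= W -> `|x * y * z| <= W ^+ 3.
Proof.
move=> xW yW zW; rewrite !normrM !exprS expr0 mulr1 mulrA.
by rewrite !ler_pM ?mulr_ge0.
Qed.

Lemma norm_mul4_le (x y z t W : R) :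
  `|x| <= W -> `|y| <= W -> `|z| <= W -> `|t| <= W -> `|x * y * z * t| <= W ^+ 4.
Proof.
move=> xW yW zW tW; rewrite normrM exprSr.
by rewrite ler_pM ?norm_mul3_le.
Qed.

(** The square of [diag_sqr] is the double sum of [B i i ^ 2 * B k k ^ 2], each term of which is at
    most [w ^ 4]. *)
Lemma perm_stat_diag_sqr_le s : `|T s * diag_sqr s| <= (T s ^+ 2 + sum_width 4 s) / 2.
Proof.
apply: le_trans (mulr_le_half_sqr _ _) _.
rewrite ler_pM2r ?invr_gt0 // lerD2l /diag_sqr /sum_width expr2 big_distrl /=.
apply: ler_sum => i _; rewrite big_distrr /=; apply: ler_sum => k _.
have [_ _ ii kk _] := swap_width_ge s i k.
have := norm_mul4_le ii ii kk kk; apply: le_trans.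
by apply: le_trans (ler_norm _) => //; rewrite expr2 -!mulrA.
Qed.

End SwapExpansion.

(** * Expansions by transpositions *)

Section DoubleSums.
Variables (R : realFieldType) (n : nat).
Implicit Types F G : 'I_n -> 'I_n -> R.

Lemma eq_sum2 F G : (forall i k, F i k = G i k) ->
  \sum_i \sum_k F i k = \sum_i \sum_k G i k.
Proof. by move=> FG; apply: eq_bigr => i _; apply: eq_bigr => k _. Qed.

Lemma sum2D F G : \sum_i \sum_k (F i k + G i k) =
  \sum_i \sum_k F i k + \sum_i \sum_k G i k.
Proof. by rewrite -big_split; apply: eq_bigr => i _; rewrite big_split. Qed.

Lemma sum2N F : \sum_i \sum_k (- F i k) = - \sum_i \sum_k F i k.
Proof. by rewrite -sumrN; apply: eq_bigr => i _; rewrite sumrN. Qed.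

Lemma sum2Z c F : \sum_i \sum_k (c * F i k) = c * \sum_i \sum_k F i k.
Proof. by rewrite mulr_sumr; apply: eq_bigr => i _; rewrite mulr_sumr. Qed.

Lemma sum2Zr c F : \sum_i \sum_k (F i k * c) = (\sum_i \sum_k F i k) * c.
Proof. by rewrite mulr_suml; apply: eq_bigr => i _; rewrite mulr_suml. Qed.

Lemma sum2M (x y : 'I_n -> R) : \sum_i \sum_k x i * y k = (\sum_i x i) * \sum_k y k.
Proof. by rewrite big_distrlr. Qed.

Lemma norm_sum2_le F G : (forall i k, `|F i k| <= G i k) ->
  `|\sum_i \sum_k F i k| <= \sum_i \sum_k G i k.
Proof.
move=> FG; apply: le_trans (ler_norm_sum _ _ _) _; apply: ler_sum => i _.
by apply: le_trans (ler_norm_sum _ _ _) _; apply: ler_sum.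
Qed.

End DoubleSums.

(** * Taylor expansions of [E[T f(T)]] and control of their coefficients *)

Section SteinExpansion.
Variables (R : realFieldType) (n : nat) (a : 'I_n -> 'I_n -> R).
Hypothesis n2 : (2 <= n)%N.
Hypothesis rowa : forall i, \sum_j a i j = 0.
Hypothesis cola : forall j, \sum_i a i j = 0.
Hypothesis suma2 : \sum_i \sum_j a i j ^+ 2 = n.-1%:R.

Implicit Types (s : 'S_n) (i k : 'I_n).

Local Notation B := (perm_entry a).
Local Notation T := (perm_stat a).
Local Notation delta := (swap_shift a).
Local Notation w := (swap_width a).
Local Notation W := (sum_width a).
Local Notation bb := (diag_sqr a).
Local Notation bBb := (diag_form a).
Local Notation S4 := (\sum_i \sum_j a i j ^+ 4).
Local Notation L3 := (\sum_i \sum_j a i j ^+ 3).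

(** Third moments are interpolated between second and fourth ones. The choice [t = DA A], made in
    [stein_gap_le], turns both terms into multiples of [n D]. *)
Lemma pmean_sum_width3 t : 0 < t -> pmean (W 3) <= 8 * n%:R * t + 128 * S4 / t.
Proof.
move=> t0.
apply: le_trans (_ : pmean (fun s => t / 2 * W 2 s + t^-1 / 2 * W 4 s) <= _); last first.
  rewrite pmeanD !pmeanZ.
  have h2 := pmean_sum_width2 n2 suma2.
  have h4 := pmean_sum_width4 a.
  apply: le_trans (lerD (ler_wpM2l _ h2) (ler_wpM2l _ h4)) _.
  - by rewrite divr_ge0 // ltW.
  - by rewrite divr_ge0 ?invr_ge0 // ltW.
  - by rewrite le_eqVlt; apply/orP; left; apply/eqP; field; rewrite gt_eqF.
apply: le_pmean => s; rewrite /sum_width -!sum2Z -sum2D.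
apply: ler_sum => i _; apply: ler_sum => k _; set x := w s i k.
have -> : t / 2 * x ^+ 2 + t^-1 / 2 * x ^+ 4 = x ^+ 3 + (2 * t)^-1 * (x * (t - x)) ^+ 2.
  by field; rewrite gt_eqF.
by rewrite lerDl mulr_ge0 ?sqr_ge0 // invr_ge0 mulr_ge0 // ltW.
Qed.

(** This is the coefficient of [g'(T)] once a transposition has turned the products [B i k * B k i]
    into [B i i * B k k]; see [pmean_return_form_le2]. *)
Lemma sum_diag_shift s :
  \sum_i \sum_k B s i i * B s k k * delta s i k = 2 * bBb s - 2 * (T s * bb s).
Proof.
transitivity (\sum_i \sum_k (B s i i * B s k k * B s i k + B s k k * B s i i * B s k i
   + - (B s i i ^+ 2 * B s k k) + - (B s i i * B s k k ^+ 2))).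
  by apply: eq_sum2 => i k; rewrite /swap_shift; ring.
rewrite !sum2D !sum2N !sum2M -/(bBb s) [X in _ + X + _ + _]exchange_big /= -/(bBb s).
by rewrite -/(T s) -/(bb s); ring.
Qed.

(** This is the coefficient of [f'(T)] in the Stein identity. The products with a diagonal entry
    vanish by the row and column sums; what exceeds [n - 1] is bounded by the two [return_form]
    lemmas. *)
Lemma sum_perm_entry_shift s :
  \sum_i \sum_k B s i k * delta s i k = n%:R - 1 + \sum_i \sum_k B s i k * B s k i.
Proof.
transitivity (\sum_i \sum_k (B s i k ^+ 2 + B s i k * B s k i
   + - (B s i i * B s i k) + - (B s i k * B s k k))).
  by apply: eq_sum2 => i k; rewrite /swap_shift; ring.
rewrite !sum2D !sum2N (sum_perm_entry a s (fun x => x ^+ 2)) suma2 natr_pred //.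
have -> : \sum_i \sum_k B s i i * B s i k = 0.
  by apply: big1 => i _; rewrite -mulr_sumr sum_perm_entry_row // mulr0.
have -> : \sum_i \sum_k B s i k * B s k k = 0.
  by rewrite exchange_big; apply: big1 => k _; rewrite -mulr_suml sum_perm_entry_col // mul0r.
by ring.
Qed.

(** This is the coefficient of [f''(T) / 2]. Exchanging the names [i] and [k] merges equal sums, and
    zero row and column sums kill the two terms containing a squared diagonal entry. All survivors
    but [L3] are shown below to be of order [S4] in mean against [g (T s)]. *)
Lemma sum_perm_entry_shift2 s :
  \sum_i \sum_k B s i k * delta s i k ^+ 2 =
  L3 + 3 * (\sum_i \sum_k B s i k ^+ 2 * B s k i)
  - 2 * (\sum_i (\sum_j a i j ^+ 2) * B s i i)
  - 2 * (\sum_k (\sum_j a j (s k) ^+ 2) * B s k k)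
  - 4 * (\sum_i \sum_k B s i k * B s k i * B s i i) + 2 * bBb s.
Proof.
transitivity (\sum_i \sum_k (B s i k ^+ 3 + B s k i ^+ 2 * B s i k
   + 2 * (B s i k ^+ 2 * B s k i) + B s i i ^+ 2 * B s i k
   + B s i k * B s k k ^+ 2 + - (2 * (B s i k ^+ 2 * B s i i))
   + - (2 * (B s i k ^+ 2 * B s k k)) + - (2 * (B s i k * B s k i * B s i i))
   + - (2 * (B s k i * B s i k * B s k k)) + 2 * (B s i i * B s k k * B s i k))).
  by apply: eq_sum2 => i k; rewrite /swap_shift; ring.
rewrite !sum2D !sum2N !sum2Z (sum_perm_entry a s (fun x => x ^+ 3)).
have -> : \sum_i \sum_k B s k i ^+ 2 * B s i k = \sum_i \sum_k B s i k ^+ 2 * B s k i.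
  by rewrite exchange_big.
have -> : \sum_i \sum_k B s k i * B s i k * B s k k
   = \sum_i \sum_k B s i k * B s k i * B s i i by rewrite exchange_big.
have -> : \sum_i \sum_k B s i i ^+ 2 * B s i k = 0.
  by apply: big1 => i _; rewrite -mulr_sumr sum_perm_entry_row // mulr0.
have -> : \sum_i \sum_k B s i k * B s k k ^+ 2 = 0.
  by rewrite exchange_big; apply: big1 => k _; rewrite -mulr_suml sum_perm_entry_col // mul0r.
have -> : \sum_i \sum_k B s i k ^+ 2 * B s i i = \sum_i (\sum_j a i j ^+ 2) * B s i i.
  apply: eq_bigr => i _; rewrite -mulr_suml; congr (_ * _).
  by rewrite [RHS](reindex_inj (@perm_inj _ s)).
have -> : \sum_i \sum_k B s i k ^+ 2 * B s k k = \sum_k (\sum_j a j (s k) ^+ 2) * B s k k.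
  by rewrite exchange_big; apply: eq_bigr => k _; rewrite -mulr_suml.
by rewrite -/(bBb s); ring.
Qed.

Lemma pmean_swap_form (X Y : 'S_n -> 'I_n -> 'I_n -> R) (g : R -> R) :
  (forall s i k, X (tperm i k * s)%g i k = Y s i k) ->
  pmean (fun s => (\sum_i \sum_k X s i k) * g (T s)) =
  pmean (fun s => \sum_i \sum_k Y s i k * g (T s + delta s i k)).
Proof.
move=> XY; rewrite -(pmean_sum_swap (X := fun s i k => X s i k * g (T s))).
  by apply: eq_pmean => s; rewrite sum2Zr.
by move=> s i k; rewrite XY perm_stat_tperm.
Qed.

(** * Forms in the entries of [B] against a bounded Lipschitz function of [T] *)

Section FirstOrder.
Variables (g : R -> R) (G0 G1 : R).
Hypothesis gG0 : forall x, `|g x| <= G0.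
Hypothesis gG1 : forall x h, `|g (x + h) - g x| <= G1 * `|h|.

Let G0_ge0 : 0 <= G0. Proof. exact: le_trans (gG0 0). Qed.
Let G1_ge0 : 0 <= G1.
Proof.
apply: le_trans (_ : `|g (0 + 1) - g 0| <= _) => //.
by rewrite -[leRHS]mulr1 -[X in _ * X]normr1.
Qed.

Lemma shifted_form_le (Y : 'S_n -> 'I_n -> 'I_n -> R) m s :
  (forall i k, `|Y s i k| <= w s i k ^+ m) ->
  `|\sum_i \sum_k Y s i k * (g (T s + delta s i k) - g (T s))| <= G1 * W m.+1 s.
Proof.
move=> Yw; rewrite /sum_width -sum2Z; apply: norm_sum2_le => i k.
have [_ _ _ _ dw] := swap_width_ge a s i k.
rewrite normrM mulrC exprSr mulrA.
apply: le_trans (_ : (G1 * `|delta s i k|) * `|Y s i k| <= _).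
  exact: ler_wpM2r.
by rewrite -mulrA -mulrA ler_wpM2l // mulrC ler_pM.
Qed.

(** The transposition turns [B i k * B k i] into [B i i * B k k], whose double sum is [T ^ 2], of
    mean at most 1. Replacing the shifted argument by [T] costs [G1 * W 3]. *)
Lemma pmean_return_form_le1 :
  `|pmean (fun s => (\sum_i \sum_k B s i k * B s k i) * g (T s))|
    <= G0 + G1 * pmean (W 3).
Proof.
rewrite (pmean_swap_form (Y := fun s i k => B s i i * B s k k)); last first.
  by move=> s i k; rewrite perm_entryLR perm_entryRL.
apply: le_trans (_ : pmean (fun s => T s ^+ 2 * G0 + G1 * W 3 s) <= _); last first.
  rewrite pmeanD pmeanZ pmeanZr lerD2r -[leRHS]mul1r.
  by apply: ler_wpM2r => //; apply: pmean_perm_stat2.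
apply: norm_pmean_le => s.
rewrite (_ : \sum_i \sum_k _ = T s ^+ 2 * g (T s) +
  \sum_i \sum_k B s i i * B s k k * (g (T s + delta s i k) - g (T s))); last first.
  under [in RHS]eq_sum2 do rewrite mulrBr.
  rewrite sum2D sum2N sum2Zr sum2M -/(T s); ring.
apply: le_trans (ler_normD _ _) (lerD _ _).
  by rewrite normrM ger0_norm ?sqr_ge0 // ler_wpM2l // sqr_ge0.
apply: (shifted_form_le (Y := fun s i k => B s i i * B s k k)) => i k.
have [_ _ ii kk _] := swap_width_ge a s i k.
by rewrite normrM expr2 ler_pM.
Qed.

(** After the transposition the form is the sum of [B i i ^ 2 * B k k], that is [T] times the
    squared norm of the diagonal. The constant 130 is [256 / 2] plus 2, as [1/2 <= 2 S4]. *)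
Lemma pmean_cubic_return_le :
  `|pmean (fun s => (\sum_i \sum_k B s i k ^+ 2 * B s k i) * g (T s))|
    <= (130 * G0 + 256 * G1) * S4.
Proof.
rewrite (pmean_swap_form (Y := fun s i k => B s i i ^+ 2 * B s k k)); last first.
  by move=> s i k; rewrite perm_entryLR perm_entryRL.
apply: le_trans (_ : pmean (fun s => (T s ^+ 2 + W 4 s) / 2 * G0 + G1 * W 4 s) <= _);
    last first.
  rewrite pmeanD pmeanZ !pmeanZr pmeanD.
  have h1 := ler_wpM2r G0_ge0 (pmean_perm_stat2 n2 cola suma2).
  have h2 := ler_wpM2r G0_ge0 (pmean_sum_width4 a).
  have h3 := ler_wpM2l G1_ge0 (pmean_sum_width4 a).
  have h4 := ler_wpM2r G0_ge0 (sum4_ge n2 suma2).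
  lra.
apply: norm_pmean_le => s.
rewrite (_ : \sum_i \sum_k _ = T s * bb s * g (T s) +
  \sum_i \sum_k B s i i ^+ 2 * B s k k * (g (T s + delta s i k) - g (T s))); last first.
  under [in RHS]eq_sum2 do rewrite mulrBr.
  rewrite sum2D sum2N sum2Zr sum2M -/(T s) -/(bb s); ring.
apply: le_trans (ler_normD _ _) (lerD _ _).
  by rewrite normrM ler_pM // perm_stat_diag_sqr_le.
apply: (shifted_form_le (Y := fun s i k => B s i i ^+ 2 * B s k k)) => i k.
have [_ _ ii kk _] := swap_width_ge a s i k.
by rewrite expr2 norm_mul3_le.
Qed.

Lemma pmean_diag_form_le :
  `|pmean (fun s => bBb s * g (T s))| <= 3 * G0 * S4.
Proof.
apply: le_trans (_ : pmean (fun s => `|bBb s| * G0) <= _).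
  by apply: norm_pmean_le => s; rewrite normrM ler_wpM2l.
by rewrite pmeanZr [leRHS]mulrAC; apply: ler_wpM2r => //; apply: pmean_diag_form.
Qed.

(** Here the transposition produces the quadratic form [diag_form]. *)
Lemma pmean_diag_return_le :
  `|pmean (fun s => (\sum_i \sum_k B s i k * B s k i * B s i i) * g (T s))|
    <= (3 * G0 + 256 * G1) * S4.
Proof.
rewrite (pmean_swap_form (Y := fun s i k => B s i i * B s k k * B s i k)); last first.
  by move=> s i k; rewrite perm_entryLR perm_entryRL perm_entryL.
apply: le_trans (_ : pmean (fun s => `|bBb s| * G0 + G1 * W 4 s) <= _); last first.
  rewrite pmeanD pmeanZ !pmeanZr.
  have h2 := ler_wpM2r G0_ge0 (pmean_diag_form n2 cola suma2).
  have h3 := ler_wpM2l G1_ge0 (pmean_sum_width4 a).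
  lra.
apply: norm_pmean_le => s.
rewrite (_ : \sum_i \sum_k _ = bBb s * g (T s) +
  \sum_i \sum_k B s i i * B s k k * B s i k * (g (T s + delta s i k) - g (T s)));
    last first.
  under [in RHS]eq_sum2 do rewrite mulrBr.
  rewrite sum2D sum2N sum2Zr -/(bBb s); ring.
apply: le_trans (ler_normD _ _) (lerD _ _).
  by rewrite normrM ler_wpM2l.
apply: (shifted_form_le (Y := fun s i k => B s i i * B s k k * B s i k)) => i k.
have [ik _ ii kk _] := swap_width_ge a s i k.
exact: norm_mul3_le.
Qed.

(** Transposing spreads the diagonal entry [B i i] over [B i k], so that the main term is a weighted
    sum of row or column sums and vanishes. Only the increment of [g] remains. *)
Lemma pmean_weighted_diag_le (v : 'S_n -> 'I_n -> R) (u : 'S_n -> 'I_n -> 'I_n -> R) :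
  (forall s i k, v (tperm i k * s)%g i = u s i k) ->
  (forall s i k, 0 <= u s i k) ->
  (forall s, \sum_i \sum_k u s i k * B s i k = 0) ->
  (forall s, \sum_i \sum_k u s i k ^+ 2 <= n%:R ^+ 2 * S4) ->
  `|pmean (fun s => (\sum_i v s i * B s i i) * g (T s))| <= 129 * G1 * S4.
Proof.
move=> vu u0 uB0 u2.
have n0 := n_gt0 R n2.
rewrite -(ler_pM2l n0) -[X in X * _](gtr0_norm n0) -normrM -pmeanZ.
(* The factor [n] becomes a sum over a dummy index [k], the partner of [i] in the transposition. *)
rewrite (eq_pmean (G := fun s => (\sum_i \sum_(k < n) v s i * B s i i) * g (T s))); last first.
  move=> s; rewrite mulrA; congr (_ * _); rewrite mulr_sumr; apply: eq_bigr => i _.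
  by rewrite sumr_cst.
rewrite (pmean_swap_form (X := fun s i k => v s i * B s i i)
  (Y := fun s i k => u s i k * B s i k)); last first.
  by move=> s i k; rewrite vu perm_entryL.
apply: le_trans (_ : pmean (fun s =>
    G1 * ((n%:R^-1 * (n%:R ^+ 2 * S4) + n%:R * W 4 s) / 2)) <= _); last first.
  rewrite pmeanZ pmeanZr pmeanD pmean_cst pmeanZ.
  have h := ler_wpM2l (ltW n0) (ler_wpM2l G1_ge0 (pmean_sum_width4 a)).
  have h4 := ler_wpM2l (ltW n0) (ler_wpM2l G1_ge0 (sum4_ge n2 suma2)).
  have -> : n%:R^-1 * (n%:R ^+ 2 * S4) = n%:R * S4 by field; rewrite gt_eqF.
  by have := mulr_ge0 (ltW n0) G1_ge0; lra.
apply: norm_pmean_le => s.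
rewrite (_ : \sum_i \sum_k _ =
  \sum_i \sum_k u s i k * B s i k * (g (T s + delta s i k) - g (T s))); last first.
  under [in RHS]eq_sum2 do rewrite mulrBr.
  by rewrite sum2D sum2N sum2Zr uB0 mul0r subr0.
apply: le_trans (_ : \sum_i \sum_k G1 * ((n%:R^-1 * u s i k ^+ 2 + n%:R * w s i k ^+ 4) / 2)
  <= _); last first.
  rewrite sum2Z ler_wpM2l // sum2Zr sum2D !sum2Z; apply: ler_wpM2r; first by rewrite invr_ge0.
  by apply: lerD => //; rewrite ler_wpM2l ?invr_ge0 // ltW.
apply: norm_sum2_le => i k.
have [ik _ _ _ dw] := swap_width_ge a s i k.
apply: le_trans (_ : G1 * (u s i k * w s i k ^+ 2) <= _).
  rewrite !normrM (ger0_norm (u0 _ _ _)) mulrC.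
  apply: le_trans (_ : G1 * `|delta s i k| * (u s i k * `|B s i k|) <= _).
    by apply: ler_wpM2r => //; rewrite mulr_ge0.
  rewrite -mulrA ler_wpM2l // mulrCA ler_wpM2l // expr2 ler_pM //.
rewrite ler_wpM2l //.
(* Young's inequality with weight [n] balances [u ^ 2], of total at most [n ^ 2 * S4], against
   [w ^ 4], of mean total at most [256 * S4]. *)
have -> : (n%:R^-1 * u s i k ^+ 2 + n%:R * w s i k ^+ 4) / 2 =
  u s i k * w s i k ^+ 2 + n%:R^-1 / 2 * (u s i k - n%:R * w s i k ^+ 2) ^+ 2.
  by field; rewrite gt_eqF.
by rewrite lerDl mulr_ge0 ?sqr_ge0 // divr_ge0 ?invr_ge0 // ltW.
Qed.

Lemma pmean_row_weight_le :
  `|pmean (fun s => (\sum_i (\sum_j a i j ^+ 2) * B s i i) * g (T s))|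
    <= 129 * G1 * S4.
Proof.
apply: (pmean_weighted_diag_le (v := fun s i => \sum_j a i j ^+ 2)
  (u := fun s i k => \sum_j a i j ^+ 2)) => // [s i k|s|s].
- by apply: sumr_ge0 => j _; apply: sqr_ge0.
- by apply: big1 => i _; rewrite -mulr_sumr sum_perm_entry_row // mulr0.
under eq_bigr do rewrite sumr_cst.
rewrite -mulr_sumr expr2 -mulrA ler_wpM2l // mulr_sumr; apply: ler_sum => i _.
apply: le_trans (sqr_sum_le _) _; rewrite ler_wpM2l //; apply: ler_sum => j _.
by rewrite -exprM.
Qed.

(** Unlike the row weight, this weight follows the transposition and is carried to the index [k], so
    that the column sums cancel the main term. *)
Lemma pmean_col_weight_le :
  `|pmean (fun s => (\sum_k (\sum_j a j (s k) ^+ 2) * B s k k) * g (T s))|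
    <= 129 * G1 * S4.
Proof.
apply: (pmean_weighted_diag_le (v := fun s i => \sum_j a j (s i) ^+ 2)
  (u := fun s i k => \sum_j a j (s k) ^+ 2)) => // [s i k|s i k|s|s].
- by rewrite permM tpermL.
- by apply: sumr_ge0 => j _; apply: sqr_ge0.
- rewrite exchange_big; apply: big1 => k _; rewrite -mulr_sumr sum_perm_entry_col //.
  by rewrite mulr0.
rewrite sumr_cst expr2 -mulrA ler_wpM2l //.
rewrite [S4]exchange_big [in leRHS](reindex_inj (@perm_inj _ s)) mulr_sumr.
apply: ler_sum => k _.
apply: le_trans (sqr_sum_le _) _; rewrite ler_wpM2l //; apply: ler_sum => j _.
by rewrite -exprM.
Qed.

(** The constants add up the five preceding bounds: [408 = 3 * 130 + 4 * 3 + 2 * 3] and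
    [2308 = 3 * 256 + 4 * 129 + 4 * 256]. *)
Lemma pmean_shift2_form_le :
  `|pmean (fun s => (\sum_i \sum_k B s i k * delta s i k ^+ 2) * g (T s))
     - L3 * pmean (fun s => g (T s))| <= (408 * G0 + 2308 * G1) * S4.
Proof.
have h1 := pmean_cubic_return_le; have h2 := pmean_row_weight_le.
have h3 := pmean_col_weight_le; have h4 := pmean_diag_return_le.
have h5 := pmean_diag_form_le.
rewrite (eq_pmean (G := fun s => L3 * g (T s)
  + 3 * ((\sum_i \sum_k B s i k ^+ 2 * B s k i) * g (T s))
  - 2 * ((\sum_i (\sum_j a i j ^+ 2) * B s i i) * g (T s))
  - 2 * ((\sum_k (\sum_j a j (s k) ^+ 2) * B s k k) * g (T s))
  - 4 * ((\sum_i \sum_k B s i k * B s k i * B s i i) * g (T s))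
  + 2 * (bBb s * g (T s)))); last first.
  by move=> s; rewrite sum_perm_entry_shift2; ring.
rewrite !pmeanD !pmeanN !pmeanZ.
move: h1 h2 h3 h4 h5; rewrite !ler_norml.
move=> /andP[? ?] /andP[? ?] /andP[? ?] /andP[? ?] /andP[? ?].
by apply/andP; split; lra.
Qed.

End FirstOrder.

(** The first-order bound leaves [W 3], which is too large here. Keeping the linear term in [delta]
    leaves a remainder of order [W 4], and the linear coefficient, computed in [sum_diag_shift], is
    itself [O(S4)] in mean. *)
Lemma pmean_return_form_le2 (g g1 : R -> R) (G0 G1 G2 : R) :
  (forall x, `|g x| <= G0) -> (forall x, `|g1 x| <= G1) ->
  (forall x h, `|g (x + h) - g x - h * g1 x| <= G2 * h ^+ 2) ->
  `|pmean (fun s => (\sum_i \sum_k B s i k * B s k i) * g (T s))|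
    <= (4 * G0 + 266 * G1 + 256 * G2) * S4.
Proof.
move=> gG0 gG1 gG2.
have G0_ge0 : 0 <= G0 by exact: le_trans (gG0 0).
have G1_ge0 : 0 <= G1 by exact: le_trans (gG1 0).
have G2_ge0 : 0 <= G2.
  by have := le_trans (normr_ge0 _) (gG2 0 1); rewrite expr1n mulr1.
rewrite (pmean_swap_form (Y := fun s i k => B s i i * B s k k)); last first.
  by move=> s i k; rewrite perm_entryLR perm_entryRL.
apply: le_trans (_ : pmean (fun s => T s ^+ 2 * G0 +
   (2 * `|bBb s| + (T s ^+ 2 + W 4 s)) * G1 + G2 * W 4 s) <= _); last first.
  rewrite !pmeanD !pmeanZ !pmeanZr !pmeanD !pmeanZ.
  have h0 := ler_wpM2r G0_ge0 (pmean_perm_stat2 n2 cola suma2).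
  have h1 := ler_wpM2r G1_ge0 (pmean_perm_stat2 n2 cola suma2).
  have h2 := ler_wpM2r G1_ge0 (pmean_sum_width4 a).
  have h3 := ler_wpM2l G2_ge0 (pmean_sum_width4 a).
  have h4 := ler_wpM2r G0_ge0 (sum4_ge n2 suma2).
  have h5 := ler_wpM2r G1_ge0 (sum4_ge n2 suma2).
  have h6 := ler_wpM2r G1_ge0 (pmean_diag_form n2 cola suma2).
  lra.
apply: norm_pmean_le => s.
rewrite (_ : \sum_i \sum_k _ = T s ^+ 2 * g (T s) +
  (2 * bBb s - 2 * (T s * bb s)) * g1 (T s) +
  \sum_i \sum_k B s i i * B s k k *
     (g (T s + delta s i k) - g (T s) - delta s i k * g1 (T s))); last first.
  rewrite -sum_diag_shift -sum2Zr expr2 -[T s * T s]sum2M -sum2Zr -!sum2D.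
  by apply: eq_sum2 => i k; ring.
apply: le_trans (ler_normD _ _) (lerD _ _).
  apply: le_trans (ler_normD _ _) (lerD _ _).
    by rewrite normrM ger0_norm ?sqr_ge0 // ler_wpM2l // sqr_ge0.
  rewrite normrM ler_pM //; apply: le_trans (ler_normB _ _) (lerD _ _).
    by rewrite normrM ger0_norm.
  by rewrite normrM ger0_norm //; have := perm_stat_diag_sqr_le a s; lra.
rewrite /sum_width -sum2Z; apply: norm_sum2_le => i k.
have [_ _ ii kk dw] := swap_width_ge a s i k.
rewrite normrM mulrC.
apply: le_trans (_ : G2 * `|delta s i k| ^+ 2 * (w s i k * w s i k) <= _).
  by rewrite real_normK ?num_real // ler_pM // normrM ler_pM.
rewrite -mulrA ler_wpM2l // -expr2 [leRHS](exprD _ 2 2); apply: ler_wpM2r.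
  exact: sqr_ge0.
by rewrite lerXn2r ?nnegrE ?swap_width_ge0.
Qed.

Lemma pmean_stein (f : R -> R) :
  n%:R * pmean (fun s => T s * f (T s)) =
  pmean (fun s => \sum_i \sum_k B s i k * f (T s + delta s i k)).
Proof.
rewrite -(pmean_swap_form (X := fun s i k => B s i i)).
  rewrite -pmeanZ; apply: eq_pmean => s; rewrite mulrA; congr (_ * _).
  by rewrite /perm_stat mulr_sumr; apply: eq_bigr => i _; rewrite sumr_cst.
by move=> s i k; rewrite perm_entryL.
Qed.

Lemma sum_perm_entry0 s : \sum_i \sum_k B s i k = 0.
Proof. by apply: big1 => i _; apply: sum_perm_entry_row. Qed.

(** One [F1] comes from [n - 1] in place of [n], and [F1 + F2 * W 3] from the form in
    [B i k * B k i]; the other [F2 * W 3] is the Taylor remainder. *)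
Lemma stein_expansion1 (f f1 : R -> R) (F1 F2 : R) :
  (forall x, `|f1 x| <= F1) ->
  (forall x h, `|f1 (x + h) - f1 x| <= F2 * `|h|) ->
  (forall x h, `|f (x + h) - f x - h * f1 x| <= F2 * h ^+ 2) ->
  n%:R * `|pmean (fun s => f1 (T s) - T s * f (T s))|
    <= 2 * F1 + 2 * F2 * pmean (W 3).
Proof.
move=> fF1 fF2 fF3.
have F1_ge0 : 0 <= F1 by exact: le_trans (fF1 0).
have F2_ge0 : 0 <= F2 by have := le_trans (normr_ge0 _) (fF3 0 1); rewrite expr1n mulr1.
have n0 := n_gt0 R n2.
rewrite -[X in X * _](gtr0_norm n0) -normrM pmeanB mulrBr pmean_stein.
pose Rem s := \sum_i \sum_k B s i k *
  (f (T s + delta s i k) - f (T s) - delta s i k * f1 (T s)).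
rewrite (eq_pmean (F := fun s => \sum_i \sum_k B s i k * f (T s + delta s i k))
  (G := fun s => n%:R * f1 (T s) - f1 (T s) +
    (\sum_i \sum_k B s i k * B s k i) * f1 (T s) + Rem s)); last first.
  move=> s; transitivity ((\sum_i \sum_k B s i k) * f (T s) +
    (\sum_i \sum_k B s i k * delta s i k) * f1 (T s) + Rem s).
    by rewrite -!sum2Zr -!sum2D; apply: eq_sum2 => i k; ring.
  by rewrite sum_perm_entry0 sum_perm_entry_shift; ring.
rewrite !pmeanD pmeanN pmeanZ.
have h1 := pmean_return_form_le1 fF1 fF2.
have h2 : `|pmean (fun s => f1 (T s))| <= F1.
  by rewrite -[leRHS](pmean_cst n); apply: norm_pmean_le.
have h3 : `|pmean Rem| <= F2 * pmean (W 3).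
  rewrite -pmeanZ; apply: norm_pmean_le => s.
  rewrite /sum_width -sum2Z; apply: norm_sum2_le => i k.
  have [ik _ _ _ dw] := swap_width_ge a s i k.
  rewrite normrM mulrC; apply: le_trans (_ : F2 * `|delta s i k| ^+ 2 * w s i k <= _).
    by rewrite real_normK ?num_real // ler_pM.
  rewrite -mulrA ler_wpM2l // [leRHS]exprSr; apply: ler_wpM2r; first exact: swap_width_ge0.
  by rewrite lerXn2r ?nnegrE ?swap_width_ge0.
move: h1 h2 h3; rewrite !ler_norml => /andP[? ?] /andP[? ?] /andP[? ?].
by apply/andP; split; lra.
Qed.

(** The second-order coefficient has the main part [L3], which is the correction kept on the left.
    Collecting all errors, the largest coefficient is 1666, that of [F3]. *)
Lemma stein_expansion2 (f f1 f2 : R -> R) (F1 F2 F3 : R) :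
  (forall x, `|f1 x| <= F1) -> (forall x, `|f2 x| <= F2) ->
  (forall x h, `|f2 (x + h) - f2 x| <= F3 * `|h|) ->
  (forall x h, `|f1 (x + h) - f1 x - h * f2 x| <= F3 * h ^+ 2) ->
  (forall x h, `|f (x + h) - f x - h * f1 x - h ^+ 2 / 2 * f2 x| <= F3 * `|h| ^+ 3) ->
  n%:R * `|pmean (fun s => f1 (T s) - T s * f (T s))
     + n%:R^-1 * L3 / 2 * pmean (fun s => f2 (T s))|
    <= 2000 * (F1 + F2 + F3) * S4.
Proof.
move=> fF1 fF2 fF3 fF4 fF5.
have F1_ge0 : 0 <= F1 by exact: le_trans (fF1 0).
have F2_ge0 : 0 <= F2 by exact: le_trans (fF2 0).
have F3_ge0 : 0 <= F3 by have := le_trans (normr_ge0 _) (fF4 0 1); rewrite expr1n mulr1.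
have n0 := n_gt0 R n2.
rewrite -[X in X * _](gtr0_norm n0) -normrM mulrDr pmeanB mulrBr pmean_stein.
have -> : n%:R * (n%:R^-1 * L3 / 2 * pmean (fun s => f2 (T s))) =
  (L3 * pmean (fun s => f2 (T s))) / 2 by field; rewrite gt_eqF.
pose Rem s := \sum_i \sum_k B s i k *
  (f (T s + delta s i k) - f (T s) - delta s i k * f1 (T s)
    - delta s i k ^+ 2 / 2 * f2 (T s)).
rewrite (eq_pmean (F := fun s => \sum_i \sum_k B s i k * f (T s + delta s i k))
  (G := fun s => n%:R * f1 (T s) - f1 (T s) +
    (\sum_i \sum_k B s i k * B s k i) * f1 (T s) +
    (\sum_i \sum_k B s i k * delta s i k ^+ 2) * f2 (T s) / 2 + Rem s)); last first.
  move=> s; transitivity ((\sum_i \sum_k B s i k) * f (T s) +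
    (\sum_i \sum_k B s i k * delta s i k) * f1 (T s) +
    (\sum_i \sum_k B s i k * delta s i k ^+ 2) * (f2 (T s) / 2) + Rem s).
    by rewrite -!sum2Zr -!sum2D; apply: eq_sum2 => i k; ring.
  by rewrite sum_perm_entry0 sum_perm_entry_shift; ring.
rewrite !pmeanD pmeanN pmeanZ pmeanZr.
have h1 := pmean_return_form_le2 fF1 fF2 fF4.
have h2 : `|pmean (fun s => f1 (T s))| <= F1.
  by rewrite -[leRHS](pmean_cst n); apply: norm_pmean_le.
have h3 : `|pmean Rem| <= F3 * pmean (W 4).
  rewrite -pmeanZ; apply: norm_pmean_le => s.
  rewrite /sum_width -sum2Z; apply: norm_sum2_le => i k.
  have [ik _ _ _ dw] := swap_width_ge a s i k.
  rewrite normrM mulrC; apply: le_trans (_ : F3 * `|delta s i k| ^+ 3 * w s i k <= _).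
    by rewrite ler_pM.
  rewrite -mulrA ler_wpM2l // [leRHS]exprSr; apply: ler_wpM2r; first exact: swap_width_ge0.
  by rewrite lerXn2r ?nnegrE ?swap_width_ge0.
have h4 := pmean_shift2_form_le fF2 fF3.
have k1 := ler_wpM2l F1_ge0 (sum4_ge n2 suma2).
have k2 := ler_wpM2l F2_ge0 (sum4_ge n2 suma2).
have k3 := ler_wpM2l F3_ge0 (sum4_ge n2 suma2).
have k4 := ler_wpM2l F3_ge0 (pmean_sum_width4 a).
move: h1 h2 h3 h4; rewrite !ler_norml => /andP[? ?] /andP[? ?] /andP[? ?] /andP[? ?].
by apply/andP; split; lra.
Qed.

End SteinExpansion.

Local Open Scope classical_set_scope.
Local Open Scope ring_scope.

(** * Derivatives and bounded solutions of the Stein equation *)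

Section Derivation.
Variable R : realType.
Implicit Types (f g : R -> R) (x a b : R).

Lemma is_derive_fun_eq f g x a b :
  is_derive x (1 : R) f a -> f =1 g -> a = b -> is_derive x (1 : R) g b.
Proof. by move=> df /funext <- <-. Qed.

Lemma is_deriveM1 f g x a b : is_derive x (1 : R) f a -> is_derive x (1 : R) g b ->
  is_derive x (1 : R) (fun y => f y * g y) (a * g x + f x * b).
Proof.
by move=> df dg; apply: (is_derive_fun_eq (is_deriveM df dg)) => //;
  rewrite addrC [a * _]mulrC.
Qed.

Lemma is_deriveD1 f g x a b : is_derive x (1 : R) f a -> is_derive x (1 : R) g b ->
  is_derive x (1 : R) (fun y => f y + g y) (a + b).
Proof. by move=> df dg; apply: (is_derive_fun_eq (is_deriveD df dg)). Qed.

Lemma is_deriveN1 f x a : is_derive x (1 : R) f a ->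
  is_derive x (1 : R) (fun y => - f y) (- a).
Proof. by move=> df; apply: (is_derive_fun_eq (is_deriveN df)). Qed.

Lemma is_deriveB1 f g x a b : is_derive x (1 : R) f a -> is_derive x (1 : R) g b ->
  is_derive x (1 : R) (fun y => f y - g y) (a - b).
Proof. by move=> df dg; apply: is_deriveD1 => //; apply: is_deriveN1. Qed.

Lemma is_deriveZ1 c f x a : is_derive x (1 : R) f a ->
  is_derive x (1 : R) (fun y => c * f y) (c * a).
Proof.
move=> df; apply: (is_derive_fun_eq (is_deriveM1 (is_derive_cst c x 1) df)) => //.
by rewrite mul0r add0r.
Qed.

Lemma is_deriveX1 k x : is_derive x (1 : R) (fun y : R => y ^+ k) (k%:R * x ^+ k.-1).
Proof.
apply: (is_derive_fun_eq (is_deriveX k (is_derive_id x 1))).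
  by move=> y; rewrite fctE.
by rewrite /GRing.scale /= mulr1.
Qed.

Lemma is_derive_translate f x c a : is_derive (c + x) (1 : R) f a ->
  is_derive x (1 : R) (fun y => f (c + y)) a.
Proof.
move=> df; have dc : is_derive x (1 : R) (fun y => c + y) 1.
  by apply: (is_derive_fun_eq (is_deriveD1 (is_derive_cst c x 1) (is_derive_id x 1))) => //;
    rewrite add0r.
by apply: (is_derive_fun_eq (@is_derive1_comp _ f _ x a 1 _ dc)) => //; rewrite mulr1.
Qed.

Lemma is_derive_continuous f (f1 : R -> R) :
  (forall x, is_derive x (1 : R) f (f1 x)) -> continuous f.
Proof.
by move=> df x; apply: differentiable_continuous; apply/derivable1_diffP; apply: ex_derive.
Qed.

Lemma mvt_increment f (f1 : R -> R) x h : (forall x, is_derive x (1 : R) f (f1 x)) ->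
  exists2 c, `|c - x| <= `|h| & f (x + h) - f x = h * f1 c.
Proof.
move=> df; have cf := is_derive_continuous df.
have [h0|h0] := leP 0 h.
  have xh : x <= x + h by rewrite lerDl.
  have [c cx e] := MVT_segment xh (fun y _ => df y) (continuous_subspaceT cf).
  exists c; last by rewrite e addrAC subrr add0r mulrC.
  move: cx; rewrite in_itv /= => /andP[h1 h2].
  by rewrite !ger0_norm // ?subr_ge0 // lerBlDl.
have xh : x + h <= x by rewrite gerDl ltW.
have [c cx e] := MVT_segment xh (fun y _ => df y) (continuous_subspaceT cf).
exists c; last by apply/eqP; rewrite -eqr_opp opprB e; apply/eqP; ring.
move: cx; rewrite in_itv /= => /andP[h1 h2].
by rewrite (ltr0_norm h0) ler0_norm ?subr_le0 // opprB lerBlDl -lerBlDr opprK.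
Qed.

Lemma lipschitz_of_derive f (f1 : R -> R) M x h :
  (forall x, is_derive x (1 : R) f (f1 x)) -> (forall x, `|f1 x| <= M) ->
  `|f (x + h) - f x| <= M * `|h|.
Proof.
move=> df fM; have [c _ ->] := mvt_increment x h df.
by rewrite normrM mulrC ler_wpM2r.
Qed.

Lemma taylor1_le f (f1 f2 : R -> R) M x h :
  (forall x, is_derive x (1 : R) f (f1 x)) ->
  (forall x, is_derive x (1 : R) f1 (f2 x)) -> (forall x, `|f2 x| <= M) ->
  `|f (x + h) - f x - h * f1 x| <= M * h ^+ 2.
Proof.
move=> df df1 fM; have [c ch ->] := mvt_increment x h df.
rewrite -mulrBr normrM -(real_normK (num_real h)) expr2 mulrCA ler_wpM2l //.
have M0 : 0 <= M := le_trans (normr_ge0 _) (fM 0).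
have := lipschitz_of_derive x (c - x) df1 fM; rewrite [x + _]addrC subrK => /le_trans; apply.
by rewrite ler_wpM2l.
Qed.

(** The derivative in [t] of the second-order remainder of [f] is the first-order remainder of [f1],
    so the mean value theorem reduces to [taylor1_le]. *)
Lemma taylor2_le f (f1 f2 f3 : R -> R) M x h :
  (forall x, is_derive x (1 : R) f (f1 x)) ->
  (forall x, is_derive x (1 : R) f1 (f2 x)) ->
  (forall x, is_derive x (1 : R) f2 (f3 x)) -> (forall x, `|f3 x| <= M) ->
  `|f (x + h) - f x - h * f1 x - h ^+ 2 / 2 * f2 x| <= M * `|h| ^+ 3.
Proof.
move=> df df1 df2 fM.
have M0 : 0 <= M := le_trans (normr_ge0 _) (fM 0).
pose r t := f (x + t) - f1 x * t - f2 x / 2 * t ^+ 2.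
pose r1 t := f1 (x + t) - f1 x - t * f2 x.
have dr t : is_derive t (1 : R) r (r1 t).
  have d1 := is_derive_translate (df (x + t)).
  have d2 := is_deriveZ1 (f1 x) (is_deriveX1 1 t).
  have d3 := is_deriveZ1 (f2 x / 2) (is_deriveX1 2 t).
  apply: (is_derive_fun_eq (is_deriveB1 (is_deriveB1 d1 d2) d3)) => [y|].
    by rewrite /r expr1.
  by rewrite /r1 /= expr0 expr1; field.
have [c] := mvt_increment 0 h dr; rewrite subr0 add0r => ch.
have -> : r h - r 0 = f (x + h) - f x - h * f1 x - h ^+ 2 / 2 * f2 x.
  by rewrite /r addr0; ring.
move=> ->; rewrite normrM exprS mulrCA ler_wpM2l //.
apply: le_trans (taylor1_le x c df1 df2 fM) _; rewrite ler_wpM2l //.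
by rewrite -(real_normK (num_real c)) lerXn2r ?nnegrE.
Qed.

Lemma nondecreasing_of_derive f (f1 : R -> R) a :
  (forall x, is_derive x (1 : R) f (f1 x)) -> (forall x, a <= x -> 0 <= f1 x) ->
  forall x y, a <= x -> x <= y -> f x <= f y.
Proof.
move=> df f0 x y ax xy; have cf := is_derive_continuous df.
have [c cx e] := MVT_segment xy (fun z _ => df z) (continuous_subspaceT cf).
rewrite -subr_ge0 e mulr_ge0 ?subr_ge0 // f0 //.
by move: cx; rewrite in_itv /= => /andP[h1 _]; apply: le_trans h1.
Qed.

End Derivation.

(** * Comparison principle for bounded solutions of [u' = x u + g] *)

Section BoundedStein.
Variable R : realType.

Lemma is_derive_expN_half_sqr (x : R) :
  is_derive x (1 : R) (fun y : R => expR (- (y ^+ 2 / 2))) (- x * expR (- (x ^+ 2 / 2))).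
Proof.
have d : is_derive x (1 : R) (fun y : R => - (y ^+ 2 / 2)) (- x).
  apply: (is_derive_fun_eq (is_deriveZ1 (- 2^-1) (is_deriveX1 2 x))) => [y|].
    by rewrite mulNr mulrC.
  by rewrite /= expr1; field.
apply: (is_derive_fun_eq (@is_derive1_comp _ expR _ x _ _ (is_derive_expR _) d)) => //.
by rewrite mulrC.
Qed.

(* If [u x0 > G / x0] then [(u - G / x0) exp (- x^2 / 2)] is nondecreasing
   beyond [x0], so that [u] grows like [exp (x^2 / 2)]. *)
Lemma bounded_stein_right (u g : R -> R) (M G : R) :
  (forall x, is_derive x (1 : R) u (x * u x + g x)) ->
  (forall x, `|u x| <= M) -> (forall x, `|g x| <= G) ->
  forall x, 0 < x -> x * u x <= G.
Proof.
move=> du uM gG x0 x0_gt0; rewrite leNgt; apply/negP => ltG.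
have G0 : 0 <= G := le_trans (normr_ge0 _) (gG 0).
have M0 : 0 <= M := le_trans (normr_ge0 _) (uM 0).
pose e (x : R) := expR (- (x ^+ 2 / 2)).
pose v x := (u x - G / x0) * e x.
have dv x : is_derive x (1 : R) v ((x * G / x0 + g x) * e x).
  apply: (is_derive_fun_eq (is_deriveM1 (is_deriveB1 (du x) (is_derive_cst (G / x0) x 1))
    (is_derive_expN_half_sqr x))) => //=.
  by rewrite /e; field; rewrite gt_eqF.
have v_incr := nondecreasing_of_derive (a := x0) dv.
pose c := u x0 - G / x0.
have c0 : 0 < c by rewrite subr_gt0 ltr_pdivrMr // mulrC.
(* With this step [c * x0 * h = M + 1], so the lower bound for [u (x0 + h)] exceeds [M]. *)
pose h := (M + 1) / (c * x0).
have h0 : 0 <= h by rewrite divr_ge0 ?addr_ge0 // mulr_ge0 // ltW.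
have : v x0 <= v (x0 + h).
  apply: v_incr => //; last by rewrite lerDl.
  move=> x x0x; rewrite mulr_ge0 ?expR_ge0 //.
  have : G <= x * G / x0.
    by rewrite ler_pdivlMr // mulrC ler_wpM2r.
  by move: (gG x); rewrite ler_norml => /andP[]; lra.
rewrite /v -/c => vle.
have : c * (1 + x0 * h) <= u (x0 + h) - G / x0.
  have e2 : 1 + x0 * h <= e x0 / e (x0 + h).
    rewrite /e -expRN -expRD; apply: le_trans (expR_ge1Dx _) _.
    by rewrite ler_expR; have := sqr_ge0 h; nra.
  apply: le_trans (_ : c * (e x0 / e (x0 + h)) <= _).
    by rewrite ler_wpM2l // ltW.
  by rewrite mulrA ler_pdivrMr ?expR_gt0.
have -> : c * (1 + x0 * h) = c + (M + 1).
  by rewrite /h; field; rewrite !gt_eqF.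
have : 0 <= G / x0 by rewrite divr_ge0 // ltW.
by move: (uM (x0 + h)); rewrite ler_norml => /andP[]; lra.
Qed.

(** The one-sided bound is applied to [u] and [- u]; negative [x] follow by reflection, since
    [u (- x)] solves the equation with datum [- g (- x)]. The bound depends on [G] alone, [M] only
    serving to exclude growing solutions. *)
Lemma bounded_stein_mul (u g : R -> R) (M G : R) :
  (forall x, is_derive x (1 : R) u (x * u x + g x)) ->
  (forall x, `|u x| <= M) -> (forall x, `|g x| <= G) ->
  forall x, `|x * u x| <= G.
Proof.
move=> du uM gG.
have G0 : 0 <= G := le_trans (normr_ge0 _) (gG 0).
have pos (w k : R -> R) : (forall x, is_derive x (1 : R) w (x * w x + k x)) ->
  (forall x, `|w x| <= M) -> (forall x, `|k x| <= G) -> forall x, 0 < x -> `|x * w x| <= G.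
  move=> dw wM kG x x0; rewrite ler_norml; apply/andP; split; last first.
    exact: (bounded_stein_right dw wM kG).
  rewrite lerNl -mulrN.
  apply: (bounded_stein_right (u := fun x => - w x) (g := fun x => - k x) (M := M)) => //.
  - move=> y; apply: (is_derive_fun_eq (is_deriveN1 (dw y))) => //; ring.
  - by move=> y; rewrite normrN.
  - by move=> y; rewrite normrN.
move=> x; have [x0|x0|->] := ltgtP x 0; last by rewrite mul0r normr0.
- rewrite (_ : `|x * u x| = `|(- x) * u (- (- x))|); last by rewrite opprK mulNr normrN.
  apply: (pos (fun x => u (- x)) (fun x => - g (- x))); last by rewrite oppr_gt0.
  + move=> y; have dN : is_derive y (1 : R) (fun z => - z) (- 1).
      exact: is_deriveN1 (is_derive_id _ _).
    by apply: (is_derive_fun_eq (@is_derive1_comp _ u _ y _ _ (du _) dN)) => //; ring.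
  + by [].
  + by move=> y; rewrite normrN.
- exact: pos.
Qed.

Lemma bounded_stein_derive (u g : R -> R) (M G : R) :
  (forall x, is_derive x (1 : R) u (x * u x + g x)) ->
  (forall x, `|u x| <= M) -> (forall x, `|g x| <= G) ->
  forall x, `|x * u x + g x| <= 2 * G.
Proof.
move=> du uM gG x; apply: le_trans (ler_normD _ _) _.
by have := bounded_stein_mul du uM gG x; have := gG x; lra.
Qed.

(** For [|x| >= 1] the bound on [x u] suffices. Inside, [u] differs from its value at the nearer of
    [1] and [-1] by at most [2 G], the derivative being bounded by [2 G]. *)
Lemma bounded_stein (u g : R -> R) (M G : R) :
  (forall x, is_derive x (1 : R) u (x * u x + g x)) ->
  (forall x, `|u x| <= M) -> (forall x, `|g x| <= G) ->
  forall x, `|u x| <= 3 * G.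
Proof.
move=> du uM gG.
have G0 : 0 <= G := le_trans (normr_ge0 _) (gG 0).
have u1 : `|u 1| <= G by have := bounded_stein_mul du uM gG 1; rewrite mul1r.
move=> x; have [x1|x1] := leP 1 `|x|.
  apply: le_trans (_ : `|x * u x| <= _); first by rewrite normrM ler_peMl.
  by have := bounded_stein_mul du uM gG x; lra.
have [x0|x0] := leP 0 x.
  have := lipschitz_of_derive 1 (x - 1) du (bounded_stein_derive du uM gG).
  rewrite [1 + _]addrC subrK (_ : `|x - 1| = 1 - x); last first.
    by rewrite ler0_norm ?opprB // subr_le0; move: x1; rewrite ger0_norm // => /ltW.
  have : 2 * G * (1 - x) <= 2 * G by nra.
  move=> h1 h2; have := ler_normD (u x - u 1) (u 1); rewrite subrK; lra.
have uN1 : `|u (- 1)| <= G.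
  by have := bounded_stein_mul du uM gG (- 1); rewrite mulN1r normrN.
have := lipschitz_of_derive (- 1) (x + 1) du (bounded_stein_derive du uM gG).
rewrite [- 1 + _]addrC addrK (_ : `|x + 1| = x + 1); last first.
  by rewrite ger0_norm //; move: x1; rewrite ltr0_norm //; lra.
have : 2 * G * (x + 1) <= 2 * G by nra.
move=> h1 h2; have := ler_normD (u x - u (- 1)) (u (- 1)); rewrite subrK; lra.
Qed.

End BoundedStein.

(** * Gaussian integrals *)

Section GaussianPrimitive.
Variable R : realType.
Local Notation mu := (@lebesgue_measure R).
Local Notation gd := (normal_pdf (0 : R)).

Definition normal_cdf (s x : R) : R := fine (normal_prob (0 : R) s `]-oo, x]).

Section NormalCdfLimits.
Variable s : R.
Let P : probability (measurableTypeR R) R := normal_prob (0 : R) s.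
(** Under the normal law the identity is a random variable with that law, so the limits of
    distribution functions apply to [normal_cdf]. *)
Let idTR : measurableTypeR R -> R := idfun.

#[local] HB.instance Definition _ :=
  @isMeasurableFun.Build _ _ _ _ idTR (@measurable_id _ _ setT).

Lemma normal_cdf_cvgNy : normal_cdf s @ -oo --> (0 : R).
Proof. exact/fine_cvg/(@cvg_cdfNy0 _ _ _ P idTR). Qed.

Lemma normal_cdf_cvgy : normal_cdf s @ +oo --> (1 : R).
Proof. exact/fine_cvg/(@cvg_cdfy1 _ _ _ P idTR). Qed.

End NormalCdfLimits.

Lemma normal_cdfE s x : normal_cdf s x = \int[mu]_(t in `]-oo, x]) gd s t.
Proof. by []. Qed.

Lemma Rintegral_normal_pdf s : \int[mu]_t gd s t = 1.
Proof. by rewrite /Rintegral integral_normal_pdf. Qed.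

Lemma cvg0_upper_bound (F : set_system R) {FF : ProperFilter F} (h : R -> R) (c : R) :
  h @ F --> (0 : R) -> (forall y, `|c| <= h y) -> c = 0.
Proof.
move=> h0 ch; apply/eqP; rewrite -normr_le0 leNgt; apply/negP => c0.
have hc : \forall y \near F, h y < `|c| by apply: cvgr_lt h0 _ c0.
by have /filter_ex[y] := hc; rewrite ltNge ch.
Qed.

Lemma integrable_normal_pdf_on s D : measurable D -> mu.-integrable D (EFin \o gd s).
Proof.
move=> mD; apply: (integrableS _ mD (subsetT D)) => //.
exact: integrable_normal_pdf.
Qed.

Lemma integrable_normal_pdfZ s M D : measurable D ->
  mu.-integrable D (EFin \o (fun x => M * gd s x)).
Proof.
move=> mD; have := @integrableZl _ _ _ mu D mD M _ (integrable_normal_pdf_on s mD).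
by apply: eq_integrable => // x _; rewrite /= EFinM.
Qed.

Section Primitive.
Variables (s M : R) (g : R -> R).
Hypothesis cg : continuous g.
Hypothesis gM : forall x, `|g x| <= M * gd s x.

Definition primitive x := \int[mu]_(t in `]-oo, x]) g t.

Lemma integrable_gaussian_bound D : measurable D -> mu.-integrable D (EFin \o g).
Proof.
move=> mD; apply: le_integrable (integrable_normal_pdfZ s M mD) => //.
  by apply/measurable_EFinP; apply: measurable_funTS; apply: continuous_measurable_fun.
by move=> x _ /=; rewrite lee_fin (le_trans (gM x)) // ler_norm.
Qed.

Lemma Rintegral_gaussian_bound_le D : measurable D ->
  `|\int[mu]_(t in D) g t| <= M * \int[mu]_(t in D) gd s t.
Proof.
move=> mD; apply: le_trans (le_normr_Rintegral mD (integrable_gaussian_bound mD)) _.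
rewrite -RintegralZl //; last exact: integrable_normal_pdf_on.
apply: le_Rintegral => //; last exact: integrable_normal_pdfZ.
have := integrable_norm (integrable_gaussian_bound mD).
by apply: eq_integrable.
Qed.

Lemma primitive_le x : `|primitive x| <= M * normal_cdf s x.
Proof. exact: Rintegral_gaussian_bound_le. Qed.

Lemma Rintegral_normal_tail x : \int[mu]_(t in `]x, +oo[) gd s t = 1 - normal_cdf s x.
Proof.
rewrite normal_cdfE -(Rintegral_normal_pdf s) -[in RHS]set_itvNyy.
by rewrite Rintegral_itvB //; apply: integrable_normal_pdf_on.
Qed.

Lemma primitive_compl_le x : `|\int[mu]_t g t - primitive x| <= M * (1 - normal_cdf s x).
Proof.
rewrite -Rintegral_normal_tail /primitive.
rewrite -[X in X - _](_ : \int[mu]_(t in `]-oo, +oo[) g t = _).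
  by rewrite Rintegral_itvB //;
    [exact: Rintegral_gaussian_bound_le|exact: integrable_gaussian_bound].
by rewrite set_itvNyy.
Qed.

Lemma is_derive_primitive x : is_derive x (1 : R) primitive (g x).
Proof.
have x1 : x < x + 1 by rewrite ltrDl.
have ax : ((-oo)%O < BRight x)%E by rewrite ltNyr.
have [dF F'] := @continuous_FTC1 R g -oo%O x (x + 1) x1
  (integrable_gaussian_bound (measurable_itv _)) ax (@cg x).
by apply: DeriveDef => //; rewrite -derive1E.
Qed.

End Primitive.

(** The primitive of [w1] from [-oo] and [w] differ by a constant, which is zero because both vanish
    at [-oo]. At [+oo] the primitive tends to the whole integral while [w] vanishes. *)
Lemma Rintegral_derive_eq0 (s K : R) (w w1 : R -> R) :
  gd s @ -oo --> (0 : R) -> gd s @ +oo --> (0 : R) ->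
  (forall x, is_derive x (1 : R) w (w1 x)) -> continuous w1 ->
  (forall x, `|w x| <= K * gd s x) -> (forall x, `|w1 x| <= K * gd s x) ->
  \int[mu]_t w1 t = 0.
Proof.
move=> gNy gy dw cw1 wK w1K.
have dF x := is_derive_primitive cw1 w1K x.
have cst x y : primitive w1 x - w x = primitive w1 y - w y.
  apply: (@is_derive_0_is_cst R (fun x => primitive w1 x - w x)) => z.
  by apply: (is_derive_fun_eq (is_deriveB1 (dF z) (dw z))) => //; rewrite subrr.
have Fw x : primitive w1 x - w x = 0.
  apply: (cvg0_upper_bound (F := -oo) (h := fun y => K * (normal_cdf s y + gd s y))).
    rewrite -[X in _ --> X](mulr0 K) -[X in _ --> K * X](addr0 0).
    by apply: cvgM; [exact: cvg_cst|apply: cvgD => //; exact: normal_cdf_cvgNy].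
  move=> y; rewrite (cst x y); apply: le_trans (ler_normB _ _) _.
  by rewrite mulrDr lerD // primitive_le.
apply: (cvg0_upper_bound (F := +oo) (h := fun y => K * ((1 - normal_cdf s y) + gd s y))).
  rewrite -[X in _ --> X](mulr0 K) -[X in _ --> K * X](addr0 0).
  apply: cvgM; [exact: cvg_cst|apply: cvgD => //].
  rewrite -[X in _ --> X](subrr 1).
  by apply: cvgB; [exact: cvg_cst|exact: normal_cdf_cvgy].
move=> y; rewrite -(subrK (primitive w1 y) (\int[mu]_t w1 t)).
apply: le_trans (ler_normD _ _) _; rewrite mulrDr lerD //.
  exact: primitive_compl_le.
by have /eqP := Fw y; rewrite subr_eq0 => /eqP ->.
Qed.

End GaussianPrimitive.

(** * Gaussian tails and a bounded solution of the Stein equation *)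

Section StandardGaussian.
Variable R : realType.
Local Notation mu := (@lebesgue_measure R).
Local Notation gd := (normal_pdf (0 : R)).
Local Notation g1 := (normal_pdf (0 : R) 1).
Local Notation rt2 := (Num.sqrt (2 : R)).

Lemma normal_pdf1E x : g1 x = normal_peak 1 * expR (- (x ^+ 2 / 2)).
Proof.
by rewrite normal_pdfE ?oner_neq0 // /normal_fun subr0 expr1n mulNr.
Qed.

Lemma sqrt2_neq0 : rt2 != 0.
Proof. by rewrite gt_eqF // sqrtr_gt0. Qed.

Lemma normal_pdf_sqrt2E x : gd rt2 x = normal_peak rt2 * expR (- ((x / 2) ^+ 2)).
Proof.
rewrite normal_pdfE ?sqrt2_neq0 // /normal_fun subr0 sqr_sqrtr //; congr (_ * expR _).
by rewrite -mulr_natr; field.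
Qed.

Lemma normal_pdf_sqrt2_cvgy : gd rt2 @ +oo --> (0 : R).
Proof.
have -> : gd rt2 = (fun x => normal_peak rt2 * gauss_fun (x / 2)).
  by apply/funext => x; rewrite normal_pdf_sqrt2E.
rewrite -[X in _ --> X](mulr0 (normal_peak rt2)); apply: cvgM; first exact: cvg_cst.
apply: (cvg_comp (fun x : R => x / 2) (@gauss_fun R)); last exact: cvg_gauss_fun.
by apply: gt0_cvgMly => //; exact: cvg_id.
Qed.

Lemma normal_pdf_sqrt2_cvgNy : gd rt2 @ -oo --> (0 : R).
Proof.
rewrite cvgNy_compNP (_ : gd rt2 \o -%R = gd rt2); first exact: normal_pdf_sqrt2_cvgy.
by apply/funext => x /=; rewrite !normal_pdf_sqrt2E mulNr sqrrN.
Qed.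

Lemma normal_pdf1_gt0 x : 0 < g1 x.
Proof. by rewrite normal_pdf1E mulr_gt0 ?expR_gt0 // normal_peak_gt0. Qed.

Lemma is_derive_normal_pdf1 x : is_derive x (1 : R) g1 (- x * g1 x).
Proof.
apply: (is_derive_fun_eq (is_deriveZ1 (normal_peak 1) (is_derive_expN_half_sqr x))) => [y|].
  by rewrite normal_pdf1E.
by rewrite normal_pdf1E mulrCA.
Qed.

(** Split [exp (- x^2 / 2)] into two factors [exp (- x^2 / 4)]. One is the density of variance 2;
    the other absorbs the polynomial, as [exp (x^2 / 4) >= (1 + x^2 / 8)^2 >= (1 + x^2)^2 / 64]. *)
Lemma poly4_normal_pdf1_le :
  exists2 K : R, 0 < K & forall x, (1 + x ^+ 2) ^+ 2 * g1 x <= K * gd rt2 x.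
Proof.
have p1 : 0 < normal_peak (1 : R) by rewrite normal_peak_gt0.
have p2 : 0 < normal_peak rt2 by rewrite normal_peak_gt0 // sqrt2_neq0.
exists (64 * normal_peak 1 / normal_peak rt2).
  by rewrite divr_gt0 // mulr_gt0.
move=> x; rewrite normal_pdf1E normal_pdf_sqrt2E.
have -> : 64 * normal_peak 1 / normal_peak rt2 *
  (normal_peak rt2 * expR (- (x / 2) ^+ 2)) =
  normal_peak 1 * (64 * expR (- (x / 2) ^+ 2)) by field; rewrite gt_eqF.
rewrite mulrCA ler_wpM2l ?(ltW p1) //.
have -> : - (x ^+ 2 / 2) = - (x / 2) ^+ 2 + - (x ^+ 2 / 4) by field.
rewrite expRD mulrCA [leRHS]mulrC ler_wpM2l ?expR_ge0 //.
rewrite expRN ler_pdivrMr ?expR_gt0 //.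
have -> : x ^+ 2 / 4 = x ^+ 2 / 8 + x ^+ 2 / 8 by field.
have x0 := sqr_ge0 x.
have e1 := expR_ge1Dx (x ^+ 2 / 8).
rewrite expRD -expr2; apply: le_trans (_ : 64 * (1 + x ^+ 2 / 8) ^+ 2 <= _).
  by nra.
by rewrite ler_wpM2l // lerXn2r ?nnegrE ?expR_ge0 //; lra.
Qed.

Local Notation cdf1 := (normal_cdf (1 : R)).

Lemma is_derive_normal_cdf1 x : is_derive x (1 : R) cdf1 (g1 x).
Proof.
apply: (@is_derive_primitive R 1 1 g1) => // [|y].
  exact: continuous_normal_pdf (oner_neq0 _).
by rewrite mul1r ger0_norm // ltW // normal_pdf1_gt0.
Qed.

(* [cdf1 - g1] has derivative [(1 + x) g1 <= 0] on ]-oo, -1], so if it were positive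
   at some point there, it could not vanish at -oo. *)
Lemma normal_cdf1_le x : x <= -1 -> cdf1 x <= g1 x.
Proof.
move=> x1; rewrite leNgt; apply/negP => lt0.
(* The reflection moves the problem to a right half-line, as [nondecreasing_of_derive] requires. *)
pose r y := cdf1 (- y) - g1 (- y).
have dr y : is_derive y (1 : R) r ((y - 1) * g1 (- y)).
  have dN : is_derive y (1 : R) (fun z => - z) (- 1).
    exact: is_deriveN1 (is_derive_id _ _).
  have d1 := @is_derive1_comp _ g1 _ y _ _ (is_derive_normal_pdf1 _) dN.
  have d2 := @is_derive1_comp _ cdf1 _ y _ _ (is_derive_normal_cdf1 _) dN.
  by apply: (is_derive_fun_eq (is_deriveB1 d2 d1)) => //; ring.
have r_incr := nondecreasing_of_derive (a := 1) dr.
have e0 : 0 < cdf1 x - g1 x by rewrite subr_gt0.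
have h1 : \forall y \near +oo, cdf1 (- y) < cdf1 x - g1 x.
  by apply: cvgr_lt e0; have := @normal_cdf_cvgNy R 1; rewrite cvgNy_compNP.
have h2 : \forall y \near +oo, - x <= y by apply: nbhs_pinfty_ge; exact: num_real.
have [y [ylt xy]] := filter_ex (filterI h1 h2).
have : r (- x) <= r y.
  apply: r_incr => //; last by rewrite lerNr.
  by move=> z z1; rewrite mulr_ge0 ?subr_ge0 // ltW // normal_pdf1_gt0.
by rewrite /r opprK; have := normal_pdf1_gt0 (- y); lra.
Qed.

(** Beyond 1 the difference [1 - cdf1 - g1] is nondecreasing; a positive value would persist and
    keep [cdf1] away from 1. *)
Lemma normal_ccdf1_le x : 1 <= x -> 1 - cdf1 x <= g1 x.
Proof.
move=> x1; rewrite leNgt; apply/negP => lt0.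
pose r y := 1 - cdf1 y - g1 y.
have dr y : is_derive y (1 : R) r ((y - 1) * g1 y).
  apply: (is_derive_fun_eq (is_deriveB1 (is_deriveB1 (is_derive_cst (1 : R) y 1)
    (is_derive_normal_cdf1 y)) (is_derive_normal_pdf1 y))) => //; ring.
have r_incr := nondecreasing_of_derive (a := 1) dr.
have e0 : 1 - (1 - cdf1 x - g1 x) < 1 by rewrite ltrBlDr ltrDl subr_gt0.
have h1 : \forall y \near +oo, 1 - (1 - cdf1 x - g1 x) < cdf1 y.
  by apply: cvgr_gt e0; exact: normal_cdf_cvgy.
have h2 : \forall y \near +oo, x <= y by apply: nbhs_pinfty_ge; exact: num_real.
have [y [ylt xy]] := filter_ex (filterI h1 h2).
have : r x <= r y.
  by apply: r_incr => // z z1; rewrite mulr_ge0 ?subr_ge0 // ltW // normal_pdf1_gt0.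
by rewrite /r; have := normal_pdf1_gt0 y; lra.
Qed.

(** [N] is the Gaussian mean of [q], and [f] is the primitive of [(q - N) g1] divided by [g1]. The
    bound [M] may be crude, since [bounded_stein] later replaces it by one depending on the datum
    only. *)
Lemma stein_solution (q : R -> R) (Q : R) : continuous q -> (forall x, `|q x| <= Q) ->
  exists N (f : R -> R) M, [/\ `|N| <= Q, (forall x, `|f x| <= M) &
    forall x, is_derive x (1 : R) f (x * f x + (q x - N))].
Proof.
move=> cq qQ.
have Q0 : 0 <= Q := le_trans (normr_ge0 _) (qQ 0).
have cg1 : continuous g1 := continuous_normal_pdf (oner_neq0 _).
have cqg : continuous (fun x => q x * g1 x) by move=> x; apply: cvgM; [exact: cq|exact: cg1].
have qgQ x : `|q x * g1 x| <= Q * g1 x.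
  by rewrite normrM (gtr0_norm (normal_pdf1_gt0 x)) ler_wpM2r // ltW // normal_pdf1_gt0.
pose N := \int[mu]_t (q t * g1 t).
have intqg := integrable_gaussian_bound cqg qgQ (@measurableT _ R).
have intg : mu.-integrable setT (EFin \o g1) by exact: integrable_normal_pdf_on.
have NQ : `|N| <= Q.
  have := Rintegral_gaussian_bound_le cqg qgQ (@measurableT _ R).
  by rewrite Rintegral_normal_pdf mulr1.
pose k x := (q x - N) * g1 x.
have ck : continuous k.
  move=> x; apply: cvgM; last exact: cg1.
  by apply: cvgB; [exact: cq|exact: cvg_cst].
have kQ x : `|k x| <= (2 * Q) * g1 x.
  rewrite normrM (gtr0_norm (normal_pdf1_gt0 x)) ler_wpM2r ?(ltW (normal_pdf1_gt0 x)) //.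
  by apply: le_trans (ler_normB _ _) _; have := qQ x; lra.
have k0 : \int[mu]_t k t = 0.
  rewrite (_ : \int[mu]_t k t = \int[mu]_t (q t * g1 t - N * g1 t)); last first.
    by apply: eq_Rintegral => t _; rewrite /k mulrBl.
  rewrite RintegralB //; last exact: integrable_normal_pdfZ.
  by rewrite RintegralZl // Rintegral_normal_pdf mulr1 subrr.
pose G := primitive k.
have dG x : is_derive x (1 : R) G (k x) by apply: is_derive_primitive kQ x.
(* The summand [2 * Q] serves the tails [|x| >= 1], through the comparison of [g1] with the tail
   masses, and [2 * Q / g1 1] serves the interval between. *)
exists N, (fun x => G x / g1 x), (2 * Q + 2 * Q / g1 1); split => //.
- move=> x; rewrite normrM normfV (gtr0_norm (normal_pdf1_gt0 x)).
  have b1 : `|G x| <= 2 * Q * cdf1 x by exact: primitive_le.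
  have b2 : `|G x| <= 2 * Q * (1 - cdf1 x).
    by have := primitive_compl_le ck kQ x; rewrite k0 sub0r normrN.
  have Q2 : 0 <= 2 * Q by rewrite mulr_ge0.
  have Q1 : 0 <= 2 * Q / g1 1 by rewrite divr_ge0 // ltW // normal_pdf1_gt0.
  rewrite ler_pdivrMr ?normal_pdf1_gt0 // mulrDl.
  have g0 := normal_pdf1_gt0 x.
  have [x1|x1] := leP x (-1).
    apply: le_trans b1 _; have := normal_cdf1_le x1 => h.
    by have := ler_wpM2l Q2 h; have := mulr_ge0 Q1 (ltW g0); lra.
  have [x2|x2] := leP 1 x.
    apply: le_trans b2 _; have := normal_ccdf1_le x2 => h.
    by have := ler_wpM2l Q2 h; have := mulr_ge0 Q1 (ltW g0); lra.
  (* On [[-1, 1]] the density is at least [g1 1], while [b1] and [b2] add up to [|G x| <= Q]. *)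
  have g1x : g1 1 <= g1 x.
    rewrite !normal_pdf1E ler_wpM2l ?normal_peak_ge0 // ler_expR lerN2.
    by rewrite ler_pM2r ?invr_gt0 // ; nra.
  have h1 : 2 * Q <= 2 * Q / g1 1 * g1 x.
    by rewrite mulrAC -mulrA ler_peMr // ler_pdivlMr ?normal_pdf1_gt0 // mul1r.
  by have := mulr_ge0 Q2 (ltW g0); lra.
- move=> x.
  have g0 := lt0r_neq0 (normal_pdf1_gt0 x).
  have dV := is_deriveV g0 (is_derive_normal_pdf1 x).
  apply: (is_derive_fun_eq (is_deriveM1 (dG x) dV)) => //.
  by rewrite /k /GRing.scale /=; field.
Qed.

End StandardGaussian.

(** * Normalized matrices and the Edgeworth integral *)

Lemma le_supnorm (R : realType) (q : R -> R) x : bounded_fun q -> `|q x| <= supnorm q.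
Proof.
move=> [M [Mr qM]]; apply: ub_le_sup; last by exists x.
exists (M + 1) => _ [z _ <-].
by apply: (qM (M + 1)); rewrite ?ltrDl.
Qed.

(** The integrand is a finite combination of indicators of the fibres of [p], whose measurability
    and masses are exactly what [uniform_random_perm] provides. *)
Lemma expectation_uniform_perm d (T : measurableType d) (R : realType)
    (P : probability T R) n (p : T -> 'S_n) (h : 'S_n -> R) :
  uniform_random_perm P p -> ('E_P[fun w => h (p w)] = (pmean h)%:E)%E.
Proof.
move=> Pp; rewrite unlock.
have mp s : measurable (p @^-1` [set s]) by have [] := Pp s.
transitivity (\int[P]_w (\sum_s (h s)%:E * (\1_(p @^-1` [set s]) w)%:E))%E.
  apply: eq_integral => w _.
  rewrite (bigD1 (p w)) //= big1 => [|s sp].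
    by rewrite adde0 indicE mem_set // mule1.
  by rewrite indicE memNset ?mule0 // => /= e; rewrite e eqxx in sp.
have ints s : P.-integrable setT (fun w => (h s)%:E * (\1_(p @^-1` [set s]) w)%:E)%E.
  by apply: integrableZl => //; apply: integrable_indic.
rewrite integral_sum //.
rewrite /pmean mulr_sumr -sumEFin; apply: eq_bigr => s _.
rewrite integralZl //; last exact: integrable_indic.
rewrite integral_indic // setIT; have [_ Ps] := Pp s.
by rewrite mulrC EFinM; congr (_ * _)%E; exact: Ps.
Qed.

(** * The normalized matrix, and the sizes of [DA] and [lambda1A] *)

Section HatMatrix.
Variables (R : realType) (n : nat) (A : 'M[R]_n).
Hypothesis n2 : (2 <= n)%N.

Let n0 : n%:R != 0 :> R.
Proof. by rewrite pnatr_eq0; case: (n) n2. Qed.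

Lemma breveA_row i : \sum_j breveA A i j = 0.
Proof.
under eq_bigr do rewrite mxE.
rewrite big_split /= big_split /= big_split /= !sumrN !sumr_cst -mulr_sumr.
rewrite [\sum_j \sum_k A k j]exchange_big /=.
by field.
Qed.

Lemma breveA_col j : \sum_i breveA A i j = 0.
Proof.
under eq_bigr do rewrite mxE.
rewrite big_split /= big_split /= big_split /= !sumrN !sumr_cst -mulr_sumr.
by field.
Qed.

Lemma sum_breveA_perm (s : 'S_n) : \sum_i breveA A i (s i) = \sum_i A i (s i) - muA A.
Proof.
under eq_bigr do rewrite mxE.
rewrite big_split /= big_split /= big_split /= !sumrN sumr_cst -!mulr_sumr /muA.
have -> : \sum_i \sum_k A k (s i) = \sum_i \sum_j A i j.
  by rewrite [RHS]exchange_big [RHS](reindex_inj (@perm_inj _ s)).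
by field.
Qed.

Hypothesis sig0 : 0 < sigmaA A.

Lemma hatA_row i : \sum_j hatA A i j = 0.
Proof. by under eq_bigr do rewrite mxE; rewrite -mulr_suml breveA_row mul0r. Qed.

Lemma hatA_col j : \sum_i hatA A i j = 0.
Proof. by under eq_bigr do rewrite mxE; rewrite -mulr_suml breveA_col mul0r. Qed.

Lemma hatA_sum2 : \sum_i \sum_j hatA A i j ^+ 2 = n.-1%:R.
Proof.
have sq : 0 <= n.-1%:R^-1 * \sum_i \sum_j breveA A i j ^+ 2.
  rewrite mulr_ge0 ?invr_ge0 //; apply: sumr_ge0 => i _; apply: sumr_ge0 => j _.
  exact: sqr_ge0.
have s2 : sigmaA A ^+ 2 = n.-1%:R^-1 * \sum_i \sum_j breveA A i j ^+ 2.
  by rewrite sqr_sqrtr.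
have s0 : sigmaA A ^+ 2 != 0 by rewrite expf_neq0 // gt_eqF.
transitivity ((\sum_i \sum_j breveA A i j ^+ 2) / sigmaA A ^+ 2).
  rewrite -sum2Zr; apply: eq_sum2 => i j; by rewrite mxE expr_div_n.
have m0 : n.-1%:R != 0 :> R by rewrite pnatr_eq0; case: (n) n2 => // -[].
apply: (mulIf s0); rewrite divfK // s2 mulrA divff // mul1r //.
Qed.

Lemma TA_perm_stat s : TA A s = perm_stat (hatA A) s.
Proof.
rewrite /TA -sum_breveA_perm mulr_suml; apply: eq_bigr => i _.
by rewrite /perm_entry [RHS]mxE.
Qed.

Lemma DA_sqr : DA A ^+ 2 = n%:R^-1 * \sum_i \sum_j hatA A i j ^+ 4.
Proof.
rewrite /DA; under eq_bigr do under eq_bigr do rewrite -normrX ger0_norm ?exprn_even_ge0 //.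
rewrite sqr_sqrtr // mulr_ge0 ?invr_ge0 //.
by apply: sumr_ge0 => i _; apply: sumr_ge0 => j _; apply: exprn_even_ge0.
Qed.

(** By [sum4_ge], [D ^ 2 >= 1 / (4 n)], which is at least [1 / (4 n ^ 2)]. It gives [D > 0] and lets
    errors of order [1 / n] be absorbed into [D]. *)
Lemma DA_ge : (2 * n%:R)^-1 <= DA A.
Proof.
have n1 := natr_ge2 R n2.
have i0 : 0 <= (2 * n%:R)^-1 :> R by rewrite invr_ge0 mulr_ge0.
rewrite -(@ler_pXn2r _ 2) ?nnegrE ?sqrtr_ge0 // DA_sqr.
apply: le_trans (_ : n%:R^-1 * 4^-1 <= _); last first.
  by rewrite ler_wpM2l ?invr_ge0 // sum4_ge // hatA_sum2.
have -> : (2 * n%:R)^-1 ^+ 2 = n%:R^-1 * 4^-1 * n%:R^-1 :> R by field.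
rewrite ler_piMr ?mulr_ge0 ?invr_ge0 // invf_le1; lra.
Qed.

(** Summing [|x|^3 <= D x^2 / 2 + x^4 / (2 D)], the second moments contribute at most [n D / 2] and
    the fourth moments exactly [n D / 2]. *)
Lemma lambda1A_le : `|lambda1A A| <= DA A.
Proof.
have n1 := natr_ge2 R n2.
have D0 : 0 < DA A by apply: lt_le_trans DA_ge; rewrite invr_gt0; lra.
rewrite normrM ger0_norm ?invr_ge0 // ler_pdivrMl; last lra.
apply: le_trans (_ : \sum_i \sum_j (DA A / 2 * hatA A i j ^+ 2 +
    (DA A)^-1 / 2 * hatA A i j ^+ 4) <= _).
  apply: norm_sum2_le => i j; set x := hatA A i j; rewrite normrX.
  rewrite -[x ^+ 2](real_normK (num_real x)) (_ : x ^+ 4 = `|x| ^+ 4); last first.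
    by rewrite -normrX ger0_norm // exprn_even_ge0.
  set y := `|x|.
  have -> : DA A / 2 * y ^+ 2 + (DA A)^-1 / 2 * y ^+ 4 =
    y ^+ 3 + (2 * DA A)^-1 * (y * (DA A - y)) ^+ 2 by field; rewrite gt_eqF.
  by rewrite lerDl mulr_ge0 ?sqr_ge0 // invr_ge0 mulr_ge0 // ltW.
rewrite sum2D !sum2Z hatA_sum2 natr_pred //.
have -> : \sum_i \sum_j hatA A i j ^+ 4 = n%:R * DA A ^+ 2.
  by rewrite DA_sqr mulrA divff ?mul1r.
have -> : (DA A)^-1 / 2 * (n%:R * DA A ^+ 2) = n%:R * DA A / 2 by field; rewrite gt_eqF.
lra.
Qed.

End HatMatrix.

(** * The integral of [q] against the Edgeworth density *)

Section EdgeworthIntegral.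
Variable R : realType.
Local Notation mu := (@lebesgue_measure R).
Local Notation g1 := (normal_pdf (0 : R) 1).

Lemma psiE : @psi R = g1.
Proof.
apply/funext => x; rewrite /psi derive1E; apply: derive_val.
exact: is_derive_normal_cdf1.
Qed.

Lemma derive1_e1A n (A : 'M[R]_n) x :
  derive1 (e1A A) x = (1 + 6^-1 * lambda1A A * (x ^+ 3 - 3 * x)) * g1 x.
Proof.
rewrite derive1E; apply: derive_val; set l := 6^-1 * lambda1A A.
have dp := is_deriveM1 (is_deriveB1 (is_deriveX1 2 x) (is_derive_cst (1 : R) x 1))
  (is_derive_normal_pdf1 x).
apply: (is_derive_fun_eq (is_deriveB1 (is_derive_normal_cdf1 x) (is_deriveZ1 l dp))) => [y|].
  by rewrite /e1A psiE mulrA.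
by rewrite /= expr1; ring.
Qed.

(* The integrand is the derivative of a rapidly decreasing function plus
   [(N - 3 c N2) g1], by the two Stein equations. *)
Lemma edgeworth_integral (q f f1 f2 phi : R -> R) (N N2 c F : R) :
  continuous q ->
  (forall x, is_derive x (1 : R) f (f1 x)) -> (forall x, f1 x = x * f x + (q x - N)) ->
  (forall x, is_derive x (1 : R) f1 (f2 x)) ->
  (forall x, is_derive x (1 : R) phi (x * phi x + (f2 x - N2))) ->
  (forall x, `|q x| <= F) -> (forall x, `|f x| <= F) -> (forall x, `|f1 x| <= F) ->
  (forall x, `|phi x| <= F) -> `|N| <= F -> `|N2| <= F ->
  (\int[mu]_(x in [set: R]) (q x * ((1 + c * (x ^+ 3 - 3 * x)) * g1 x))%:E
    = (N - 3 * c * N2)%:E)%E.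
Proof.
move=> cq df f1E df1 dphi qF fF f1F phiF NF N2F.
have F0 : 0 <= F := le_trans (normr_ge0 _) NF.
have [K K0 hK] := poly4_normal_pdf1_le R.
pose v x : R := (1 + x ^+ 2) ^+ 2.
pose a := `|c|.
have a0 : 0 <= a by exact: normr_ge0.
(* One constant for [r], [k] and the centred [k]: the bracket in [r] needs [12 a], and centring [k]
   needs the 2. *)
pose B := F * (2 + 12 * a).
have B0 : 0 <= B by rewrite mulr_ge0 // addr_ge0 // mulr_ge0.
have v1 x : 1 <= v x by rewrite /v; have := sqr_ge0 x; nra.
have H2 x : `|x ^+ 2 - 1| <= v x.
  by rewrite /v ler_norml; have := sqr_ge0 x; nra.
have vx x : `|x| <= v x.
  rewrite /v -(real_normK (num_real x)); have := normr_ge0 x.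
  by have := sqr_ge0 (`|x| - 1); have := sqr_ge0 (`|x| ^+ 2); nra.
have H3 x : `|x ^+ 3 - 3 * x| <= 2 * v x.
  have -> : x ^+ 3 - 3 * x = x * (x ^+ 2 - 3) by ring.
  rewrite normrM; apply: le_trans (_ : `|x| * (x ^+ 2 + 3) <= _).
    by rewrite ler_wpM2l // (le_trans (ler_normB _ _)) // !ger0_norm ?sqr_ge0.
  rewrite /v -(real_normK (num_real x)); set y := `|x|.
  have y0 : 0 <= y by exact: normr_ge0.
  have := sqr_ge0 (y - 1); have := sqr_ge0 (y * (y - 1)); have := sqr_ge0 (y ^+ 2).
  nra.
have bound (p : R -> R) : (forall x, `|p x| <= B * v x) ->
    forall x, `|p x * g1 x| <= B * K * normal_pdf 0 (Num.sqrt 2) x.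
  move=> pB x; rewrite normrM (gtr0_norm (normal_pdf1_gt0 x)).
  apply: le_trans (_ : B * v x * g1 x <= _).
    by apply: ler_wpM2r => //; rewrite ltW // normal_pdf1_gt0.
  by rewrite -mulrA -[leRHS]mulrA ler_wpM2l //; exact: hK.
(* Write [H2 = x^2 - 1], [H3 = x^3 - 3 x]. After multiplication by [g1] and differentiation,
   [- N H2 + f H3] gives [q H3 + 3 f H2], then [3 f1 + 3 x f] gives [3 f2 - 3 f H2], and [- 3 phi]
   gives [- 3 (f2 - N2)]. The sum is [q H3 + 3 N2]. *)
pose r x := f x + c * (- N * (x ^+ 2 - 1) + f x * (x ^+ 3 - 3 * x) + 3 * f1 x
  + 3 * (x * f x) - 3 * phi x).
pose w x := r x * g1 x.
pose k x := q x * (1 + c * (x ^+ 3 - 3 * x)).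
pose w1 x := (k x - (N - 3 * c * N2)) * g1 x.
have kB x : `|k x| <= F * (v x + a * (2 * v x)).
  rewrite normrM ler_pM //; apply: le_trans (ler_normD _ _) _.
  by rewrite normr1 lerD // normrM ler_wpM2l.
have CB : `|N - 3 * c * N2| <= F * (1 + 3 * a).
  apply: le_trans (ler_normB _ _) _; rewrite !normrM (ger0_norm (_ : 0 <= 3)) // -/a.
  have := ler_wpM2l a0 N2F; lra.
have dw x : is_derive x (1 : R) w (w1 x).
  have d1 := is_deriveZ1 (- N) (is_deriveB1 (is_deriveX1 2 x) (is_derive_cst (1 : R) x 1)).
  have d2 := is_deriveM1 (df x) (is_deriveB1 (is_deriveX1 3 x)
    (is_deriveZ1 3 (is_derive_id x (1 : R)))).
  have d3 := is_deriveZ1 3 (df1 x).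
  have d4 := is_deriveZ1 3 (is_deriveM1 (is_derive_id x (1 : R)) (df x)).
  have d5 := is_deriveZ1 3 (dphi x).
  have d6 := is_deriveD1 (df x) (is_deriveZ1 c
    (is_deriveB1 (is_deriveD1 (is_deriveD1 (is_deriveD1 d1 d2) d3) d4) d5)).
  apply: (is_derive_fun_eq (is_deriveM1 d6 (is_derive_normal_pdf1 x))) => //=.
  rewrite /w1 /k !f1E expr1; ring.
have ck : continuous k.
  move=> x; apply: cvgM; first exact: cq.
  have dk y : is_derive y (1 : R) (fun x => 1 + c * (x ^+ 3 - 3 * x))
      (0 + c * (3%:R * y ^+ 2 - 3 * 1)).
    exact: is_deriveD1 (is_derive_cst _ _ _) (is_deriveZ1 _ (is_deriveB1 (is_deriveX1 3 y)
      (is_deriveZ1 3 (is_derive_id y (1 : R))))).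
  exact: (is_derive_continuous dk).
have cg1 : continuous g1 := continuous_normal_pdf (oner_neq0 _).
have cw1 : continuous w1.
  move=> x; apply: cvgM; last exact: cg1.
  by apply: cvgB; [exact: ck|exact: cvg_cst].
have wB x : `|w x| <= B * K * normal_pdf 0 (Num.sqrt 2) x.
  move: x; apply: (bound r) => x; rewrite /B.
  have e1 : `|- N * (x ^+ 2 - 1)| <= F * v x by rewrite normrM normrN ler_pM.
  have e2 : `|f x * (x ^+ 3 - 3 * x)| <= F * (2 * v x) by rewrite normrM ler_pM.
  have e3 : `|x * f x| <= v x * F by rewrite normrM ler_pM.
  have Fv : F <= F * v x by rewrite ler_peMr.
  have e4 := f1F x; have e5 := phiF x; have e6 := fF x.
  apply: le_trans (ler_normD _ _) _; rewrite normrM -/a.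
  have : `|- N * (x ^+ 2 - 1) + f x * (x ^+ 3 - 3 * x) + 3 * f1 x
      + 3 * (x * f x) - 3 * phi x| <= 12 * (F * v x).
    move: e1 e2 e3 e4 e5; rewrite !ler_norml => /andP[? ?] /andP[? ?] /andP[? ?].
    by move=> /andP[? ?] /andP[? ?]; apply/andP; split; lra.
  move=> /(ler_wpM2l a0); lra.
have w1B x : `|w1 x| <= B * K * normal_pdf 0 (Num.sqrt 2) x.
  move: x; apply: (bound (fun x => k x - (N - 3 * c * N2))) => x.
  apply: le_trans (ler_normB _ _) _.
  have Fv : F <= F * v x by rewrite ler_peMr.
  have := ler_wpM2l a0 Fv; have := mulr_ge0 a0 F0.
  by have := kB x; have := CB; rewrite /B; lra.
have kgB x : `|k x * g1 x| <= B * K * normal_pdf 0 (Num.sqrt 2) x.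
  move: x; apply: (bound k) => x; apply: le_trans (kB x) _; rewrite /B.
  have Fv : F <= F * v x by rewrite ler_peMr.
  have := ler_wpM2l a0 Fv; have := mulr_ge0 a0 F0; lra.
have w0 := Rintegral_derive_eq0 (@normal_pdf_sqrt2_cvgNy R) (@normal_pdf_sqrt2_cvgy R)
  dw cw1 wB w1B.
have ckg : continuous (fun x => k x * g1 x).
  by move=> x; apply: cvgM; [exact: ck|exact: cg1].
have intkg := integrable_gaussian_bound ckg kgB (@measurableT _ R).
transitivity (\int[mu]_x (k x * g1 x)%:E)%E.
  by apply: eq_integral => x _; rewrite /k mulrA.
rewrite -[LHS]fineK; last exact: integrable_fin_num.
congr (_%:E).
move: w0; rewrite (_ : \int[mu]_t w1 t = \int[mu]_t (k t * g1 t - (N - 3 * c * N2) * g1 t)).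
  rewrite RintegralB //; last exact: integrable_normal_pdfZ.
  rewrite RintegralZl ?Rintegral_normal_pdf //; last exact: integrable_normal_pdf_on.
  by rewrite mulr1 => /eqP; rewrite subr_eq0 => /eqP.
by apply: eq_Rintegral => t _; rewrite /w1 mulrBl.
Qed.

End EdgeworthIntegral.

(** * The two Stein expansions expressed through [DA] *)

Section SteinBounds.
Variables (R : realType) (n : nat) (A : 'M[R]_n).
Hypothesis n2 : (2 <= n)%N.
Hypothesis sig0 : 0 < sigmaA A.

Let row := hatA_row A n2.
Let col := hatA_col A n2.
Let sum2 := hatA_sum2 n2 sig0.

(** Taking [t = D] in [pmean_sum_width3] gives [136 n D], hence [272 = 2 * 136]; the term [2 * F1]
    is absorbed by [1 <= 2 n D]. *)
Lemma stein_gap_le (f f1 f2 : R -> R) (F1 F2 : R) :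
  (forall x, is_derive x (1 : R) f (f1 x)) ->
  (forall x, is_derive x (1 : R) f1 (f2 x)) ->
  (forall x, `|f1 x| <= F1) -> (forall x, `|f2 x| <= F2) ->
  `|pmean (fun s => f1 (TA A s) - TA A s * f (TA A s))| <= (4 * F1 + 272 * F2) * DA A.
Proof.
move=> df df1 f1F f2F.
have F1_ge0 : 0 <= F1 := le_trans (normr_ge0 _) (f1F 0).
have F2_ge0 : 0 <= F2 := le_trans (normr_ge0 _) (f2F 0).
have n1 := natr_ge2 R n2; have n0 := n_gt0 R n2.
have Dn := DA_ge n2 sig0.
have D0 : 0 < DA A by apply: lt_le_trans Dn; rewrite invr_gt0; lra.
have h := stein_expansion1 n2 row col sum2 f1F
  (fun x h => lipschitz_of_derive x h df1 f2F) (fun x h => taylor1_le x h df df1 f2F).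
have h3 := ler_wpM2l F2_ge0 (pmean_sum_width3 n2 sum2 D0).
rewrite -(ler_pM2l n0) (eq_pmean (G := fun s => f1 (perm_stat (hatA A) s) -
  perm_stat (hatA A) s * f (perm_stat (hatA A) s))); last by move=> s; rewrite TA_perm_stat.
apply: le_trans h _.
have S4E : \sum_i \sum_j hatA A i j ^+ 4 = n%:R * DA A ^+ 2.
  by rewrite DA_sqr mulrA divff ?mul1r // gt_eqF.
have e : 128 * (n%:R * DA A ^+ 2) / DA A = 128 * (n%:R * DA A) by field; rewrite gt_eqF.
move: h3; rewrite S4E e.
have nD : 1 <= 2 * n%:R * DA A.
  by rewrite -ler_pdivrMl ?mulr1 // mulr_gt0.
by have := ler_wpM2l F1_ge0 nD; lra.
Qed.

Lemma stein_gap_expansion_le (f f1 f2 f3 : R -> R) (F1 F2 F3 : R) :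
  (forall x, is_derive x (1 : R) f (f1 x)) ->
  (forall x, is_derive x (1 : R) f1 (f2 x)) ->
  (forall x, is_derive x (1 : R) f2 (f3 x)) ->
  (forall x, `|f1 x| <= F1) -> (forall x, `|f2 x| <= F2) -> (forall x, `|f3 x| <= F3) ->
  `|pmean (fun s => f1 (TA A s) - TA A s * f (TA A s))
    + lambda1A A / 2 * pmean (fun s => f2 (TA A s))| <= 2000 * (F1 + F2 + F3) * DA A ^+ 2.
Proof.
move=> df df1 df2 f1F f2F f3F.
have n0 := n_gt0 R n2.
have h := stein_expansion2 n2 row col sum2 f1F f2F
  (fun x h => lipschitz_of_derive x h df2 f3F) (fun x h => taylor1_le x h df1 df2 f3F)
  (fun x h => taylor2_le x h df df1 df2 f3F).
rewrite -(ler_pM2l n0) (eq_pmean (G := fun s => f1 (perm_stat (hatA A) s) -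
  perm_stat (hatA A) s * f (perm_stat (hatA A) s))); last by move=> s; rewrite TA_perm_stat.
rewrite (eq_pmean (F := fun s => f2 (TA A s)) (G := fun s => f2 (perm_stat (hatA A) s)));
  last by move=> s; rewrite TA_perm_stat.
apply: le_trans h _; rewrite DA_sqr mulrCA [n%:R * _]mulrA divff ?mul1r //.
by rewrite gt_eqF.
Qed.

End SteinBounds.

Theorem theorem2p1 (R : realType) :
  exists K1 K2 K3 : R, [/\ 0 < K1, 0 < K2, 0 < K3 &
    forall (n : nat) (A : 'M[R]_n) (q : R -> R)
      (d : measure_display) (T : measurableType d) (P : probability T R)
      (p : T -> 'S_n),
    (2 <= n)%N ->
    0 < sigmaA A ->
    (forall x : R, derivable q x 1) ->
    (forall x : R, derivable (derive1 q) x 1) ->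
    bounded_fun q -> bounded_fun (derive1 q) -> bounded_fun (derive1 (derive1 q)) ->
    uniform_random_perm P p ->
    (`| 'E_P[fun w => q (TA A (p w))]
        - \int[lebesgue_measure]_(x in [set: R]) (q x * derive1 (e1A A) x)%:E |
     <= ((K1 * supnorm q + K2 * supnorm (derive1 q) + K3 * supnorm (derive1 (derive1 q)))
           * DA A ^+ 2)%:E)%E ].
Proof.
(* The estimates below yield the coefficients 88032, 7280 and 4544, all below [10 ^ 5]. *)
exists (10 ^+ 5), (10 ^+ 5), (10 ^+ 5); split; rewrite ?exprn_gt0 //.
move=> n A q d T P p n2 sig0 dq dq1 bq bq1 bq2 Pp.
have der (g : R -> R) x : derivable g x 1 -> is_derive x (1 : R) g (derive1 g x).
  by move=> dg; apply: DeriveDef => //; rewrite derive1E.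
pose q1 := derive1 q; pose q2 := derive1 q1.
have isq x : is_derive x (1 : R) q (q1 x) by apply: der.
have isq1 x : is_derive x (1 : R) q1 (q2 x) by apply: der.
pose Q0 := supnorm q; pose Q1 := supnorm q1; pose Q2 := supnorm q2.
have q0Q x : `|q x| <= Q0 by exact: le_supnorm.
have q1Q x : `|q1 x| <= Q1 by exact: le_supnorm.
have q2Q x : `|q2 x| <= Q2 by exact: le_supnorm.
have Q0_ge0 : 0 <= Q0 := le_trans (normr_ge0 _) (q0Q 0).
have Q1_ge0 : 0 <= Q1 := le_trans (normr_ge0 _) (q1Q 0).
have Q2_ge0 : 0 <= Q2 := le_trans (normr_ge0 _) (q2Q 0).
have [N [f [M [NQ fM df]]]] := stein_solution (is_derive_continuous isq) q0Q.
have qN x : `|q x - N| <= 2 * Q0.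
  by apply: le_trans (ler_normB _ _) _; have := q0Q x; lra.
pose f1 x := x * f x + (q x - N).
have fF x : `|f x| <= 6 * Q0 by have := bounded_stein df fM qN x; lra.
have f1F x : `|f1 x| <= 4 * Q0 by have := bounded_stein_derive df fM qN x; rewrite /f1; lra.
(* Differentiating a Stein equation gives one for the derivative: [f1] solves it with datum
   [f + q1], and [f2] with datum [2 f1 + q2]. Each bound just obtained supplies the boundedness that
   the comparison principle needs at the next order. *)
pose f2 x := x * f1 x + (f x + q1 x).
have df1 x : is_derive x (1 : R) f1 (f2 x).
  apply: (is_derive_fun_eq (is_deriveD1 (is_deriveM1 (is_derive_id x (1 : R)) (df x))
    (is_deriveB1 (isq x) (is_derive_cst N x (1 : R))))) => //.
  by rewrite /f2 /f1 /=; ring.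
have fq1 x : `|f x + q1 x| <= 6 * Q0 + Q1.
  by apply: le_trans (ler_normD _ _) _; rewrite lerD.
have f2F x : `|f2 x| <= 12 * Q0 + 2 * Q1.
  by have := bounded_stein_derive df1 f1F fq1 x; rewrite /f2; lra.
pose f3 x := x * f2 x + (2 * f1 x + q2 x).
have df2 x : is_derive x (1 : R) f2 (f3 x).
  apply: (is_derive_fun_eq (is_deriveD1 (is_deriveM1 (is_derive_id x (1 : R)) (df1 x))
    (is_deriveD1 (df x) (isq1 x)))) => //.
  by rewrite /f3 /f2 /f1 /=; ring.
have f1q2 x : `|2 * f1 x + q2 x| <= 8 * Q0 + Q2.
  apply: le_trans (ler_normD _ _) _; rewrite normrM ger0_norm //.
  by have := f1F x; have := q2Q x; lra.
have f3F x : `|f3 x| <= 16 * Q0 + 2 * Q2.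
  by have := bounded_stein_derive df2 f2F f1q2 x; rewrite /f3; lra.
(* A second Stein equation, with datum [f2], compares the mean of [f2 (T)] with its Gaussian value
   [N2]. *)
have [N2 [phi [M2 [N2F phiM dphi]]]] := stein_solution (is_derive_continuous df2) f2F.
have f2N x : `|f2 x - N2| <= 24 * Q0 + 4 * Q1.
  by apply: le_trans (ler_normB _ _) _; have := f2F x; lra.
pose phi1 x := x * phi x + (f2 x - N2).
have phiF x : `|phi x| <= 72 * Q0 + 12 * Q1.
  by have := bounded_stein dphi phiM f2N x; lra.
have phi1F x : `|phi1 x| <= 48 * Q0 + 8 * Q1.
  by have := bounded_stein_derive dphi phiM f2N x; rewrite /phi1; lra.
pose phi2 x := x * phi1 x + (phi x + f3 x).
have dphi1 x : is_derive x (1 : R) phi1 (phi2 x).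
  apply: (is_derive_fun_eq (is_deriveD1 (is_deriveM1 (is_derive_id x (1 : R)) (dphi x))
    (is_deriveB1 (df2 x) (is_derive_cst N2 x (1 : R))))) => //.
  by rewrite /phi2 /phi1 /=; ring.
have phif3 x : `|phi x + f3 x| <= 88 * Q0 + 12 * Q1 + 2 * Q2.
  by apply: le_trans (ler_normD _ _) _; have := phiF x; have := f3F x; lra.
have phi2F x : `|phi2 x| <= 176 * Q0 + 24 * Q1 + 4 * Q2.
  by have := bounded_stein_derive dphi1 phi1F phif3 x; rewrite /phi2; lra.
have b1 := stein_gap_expansion_le n2 sig0 df df1 df2 f1F f2F f3F.
have b2 := stein_gap_le n2 sig0 dphi dphi1 phi1F phi2F.
have b3 := lambda1A_le n2 sig0.
pose l := lambda1A A; pose D := DA A.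
have D0 : 0 <= D by exact: sqrtr_ge0.
rewrite (expectation_uniform_perm (fun s => q (TA A s)) Pp).
have -> : (\int[lebesgue_measure]_(x in [set: R]) (q x * derive1 (e1A A) x)%:E =
    (N - 3 * (6^-1 * l) * N2)%:E)%E.
  under eq_integral do rewrite derive1_e1A.
  have qF' x : `|q x| <= 72 * Q0 + 12 * Q1 by have := q0Q x; lra.
  have fF' x : `|f x| <= 72 * Q0 + 12 * Q1 by have := fF x; lra.
  have f1F' x : `|f1 x| <= 72 * Q0 + 12 * Q1 by have := f1F x; lra.
  have NF' : `|N| <= 72 * Q0 + 12 * Q1 by lra.
  have N2F' : `|N2| <= 72 * Q0 + 12 * Q1 by lra.
  exact (edgeworth_integral (6^-1 * l) (is_derive_continuous isq) df (fun=> erefl) df1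
    dphi qF' fF' f1F' phiF NF' N2F').
rewrite -EFinB /= lee_fin.
have e1 : pmean (fun s => f1 (TA A s) - TA A s * f (TA A s)) =
    pmean (fun s => q (TA A s)) - N.
  rewrite -[N in RHS](pmean_cst n) -pmeanB; apply: eq_pmean => s.
  by rewrite /f1 addrAC subrr add0r.
have e2 : pmean (fun s => phi1 (TA A s) - TA A s * phi (TA A s)) =
    pmean (fun s => f2 (TA A s)) - N2.
  rewrite -[N2 in RHS](pmean_cst n) -pmeanB; apply: eq_pmean => s.
  by rewrite /phi1 addrAC subrr add0r.
rewrite e1 in b1; rewrite e2 in b2.
set Eq := pmean (fun s => q (TA A s)) in b1 *.
set Ef2 := pmean (fun s => f2 (TA A s)) in b1 b2.
(* Since [3 / 6 = 1 / 2], the correction in the Edgeworth integral matches the one in [b1] with [N2]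
   in place of [Ef2]. The replacement costs [|l| / 2 * O(D)], which is [O(D ^ 2)] because
   [|l| <= D]. *)
have -> : Eq - (N - 3 * (6^-1 * l) * N2) =
  (Eq - N + l / 2 * Ef2) - l / 2 * (Ef2 - N2) by field.
apply: le_trans (ler_normB _ _) _.
have b4 : `|l / 2 * (Ef2 - N2)| <= D / 2 *
    ((4 * (48 * Q0 + 8 * Q1) + 272 * (176 * Q0 + 24 * Q1 + 4 * Q2)) * D).
  by rewrite normrM ler_pM // normrM ler_pM // ger0_norm // invr_ge0.
apply: le_trans (lerD b1 b4) _; rewrite -/D -/Q0 -/Q1 -/Q2.
have D2 : 0 <= D ^+ 2 by exact: sqr_ge0.
have := mulr_ge0 Q0_ge0 D2; have := mulr_ge0 Q1_ge0 D2; have := mulr_ge0 Q2_ge0 D2.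
lra.
Qed.
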